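(* Let $G$ be a walk-regular and strongly co-edge-regular graph with parameters $(n,k,2,\ell)$ whose smallest eigenvalue is at least $-3$. If $k\geqslant 120$, then $G$ is a $p\times q$-grid with $p+q=k+2$ and $\ell=k-2$.
   Context: All graphs are finite, undirected and simple; eigenvalues are those of the adjacency matrix. A co-edge-regular graph with parameters $(n,k,c)$ is a $k$-regular graph on $n$ vertices, neither complete nor edgeless, in which any two distinct non-adjacent vertices have exactly $c$ common neighbours. For adjacent $x,y$, $a_{xy}$ is the number of common neighbours of $x,y$. A strongly co-edge-regular graph with parameters $(n,k,c,\ell)$ is a co-edge-regular graph with parameters $(n,k,c)$ such that for any two distinct non-adjacent vertices $x,z$, $\sum_{y\sim x,\,y\sim z}a_{xy}=\ell$. A graph with adjacency matrix $A$ is walk-regular if for every integer $r\geqslant0$ all diagonal entries of $A^r$ are equal. The $p\times q$-grid is $K_p\,\square\,K_q$. *)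

(* Defs.v *)
From HB Require Import structures.
From mathcomp Require Import all_boot all_order all_algebra.

Set Implicit Arguments.
Unset Strict Implicit.
Unset Printing Implicit Defensive.

Import GRing.Theory Num.Theory.

(* A simple graph is a symmetric irreflexive [e : rel T] on a [finType];
   symmetry and irreflexivity are separate hypotheses, not built in below. *)

Section Graphs.
Variables (T : finType) (e : rel T).

Definition nbhd (x : T) : {set T} := [set y | e x y].

Definition common_nbrs (x y : T) : {set T} := nbhd x :&: nbhd y.

Definition regular_graph (k : nat) : Prop := forall x : T, #|nbhd x| = k.

Definition complete_graph : Prop := forall x y : T, x != y -> e x y.

Definition edgeless_graph : Prop := forall x y : T, ~~ e x y.

Definition co_edge_regular (n k c : nat) : Prop :=
  [/\ #|T| = n, regular_graph k, ~ complete_graph, ~ edgeless_graph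
    & forall x y : T, x != y -> ~~ e x y -> #|common_nbrs x y| = c].

Definition strongly_co_edge_regular (n k c l : nat) : Prop :=
  co_edge_regular n k c /\
  (forall x z : T, x != z -> ~~ e x z ->
     \sum_(y in common_nbrs x z) #|common_nbrs x y| = l).

Definition adjmx (R : nzRingType) : 'M[R]_#|T| :=
  (\matrix_(i, j) (e (enum_val i) (enum_val j))%:R)%R.

(* The entries of the adjacency matrix powers are natural numbers, so working
   over [int] is no restriction. *)
Definition walk_regular : Prop :=
  forall (r : nat) (i j : 'I_#|T|),
    (adjmx int ^+ r)%R i i = (adjmx int ^+ r)%R j j.

End Graphs.

Definition graph_iso (T1 T2 : finType) (e1 : rel T1) (e2 : rel T2) : Prop :=
  exists2 f : T1 -> T2, bijective f & {mono f : x y / e1 x y >-> e2 x y}.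

Definition complete_rel (p : nat) : rel 'I_p := fun x y => x != y.

Definition cartesian_product (T1 T2 : finType) (e1 : rel T1) (e2 : rel T2) :
    rel (T1 * T2) :=
  fun u v => ((u.1 == v.1) && e2 u.2 v.2) || ((u.2 == v.2) && e1 u.1 v.1).

Definition grid (p q : nat) : rel ('I_p * 'I_q) :=
  cartesian_product (@complete_rel p) (@complete_rel q).
Arguments grid : clear implicits.

(* Main.v *)
Require Import Defs.
From HB Require Import structures.
From mathcomp Require Import all_boot all_order all_algebra.
From mathcomp Require Import complex zify ring.

(** Let [a x y] be the number of common neighbours of [x] and [y].  Two
    non-adjacent neighbours [y], [z] of [x] have exactly one further common
    neighbour [v].  If [v] is not a neighbour of [x], strong co-edge-regularity
    at [x], [v] gives [a x y + a x z = l]; otherwise, at [y], [z], it gives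
    [a y x + a y v = l].  Moreover a maximal clique ("line") of the local graph
    at [x] contains at most one neighbour of any other neighbour of [x].

    As the smallest eigenvalue is at least -3, the form [A + 3 I] is nonnegative;
    integer test vectors that are constant on lines then show that each local
    graph either contains a line with more than half of the vertices, or is
    nearly covered by two long lines, or is covered by three.  The two identities
    above turn this into an exact list: two disjoint cliques ([l = k - 2]), two
    cliques of size [s] sharing a vertex ([l = k - 1]), or three disjoint cliques
    of size [s] ([l = 2 k / 3 - 2]), all other shapes being contradictory.  Hence
    all vertices have the same type.  Double counting the cliques of size [s + 1]
    gives [s + 1 | 4] and [s + 1 | 3] in the last two cases, and a graph that is
    locally two disjoint cliques and has [c = 2] is a grid. *)
Set Implicit Arguments.
Unset Strict Implicit.
Unset Printing Implicit Defensive.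

Import GRing.Theory Num.Theory.

(** * The quadratic form of a graph with bounded smallest eigenvalue *)

Section SpectralForm.
Local Open Scope ring_scope.
Local Open Scope sesquilinear_scope.

(** Between two lines at [x] all bridges start at one vertex of each line. So deleting a few
    vertices from long lines leaves cliques with no edges between them, where the quadratic form is
    explicit, and a long line keeps a free vertex [y], one whose neighbours inside [N x] all lie on
    that line. Then [a x y] is exactly the size of the line minus one, and [far_pair] at free
    vertices of two disjoint lines converts their sizes into [l]. The spectral inequalities only
    give rough sizes, and two shapes survive every argument confined to one local graph: two
    disjoint long lines joined by an edge, and three equal lines with bridges. Both contain an edge
    with few common neighbours; they are refuted in the local graph of an end of that edge, where
    the values of [k] and [l] leave few possible types. *)

Lemma sym_form_ge_eigenvalue (R : rcfType) n (A : 'M[R]_n) (b : R) :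
    A^T = A -> (forall a, eigenvalue A a -> b <= a) ->
  forall v : 'rV[R]_n, b * (v *m v^T) 0 0 <= (v *m A *m v^T) 0 0.
Proof.
move=> symA eigA v.
(* Over [R[i]] the matrix becomes hermitian, so the spectral theorem gives a unitary [P]; in the
   coordinates [w] both forms are weighted sums of squared moduli. *)
pose f := real_complex R; pose AC := map_mx f A; pose vC := map_mx f v.
have conjf m (M : 'M[R]_(m, n)) : (map_mx f M)^t* = map_mx f M^T.
  by apply/matrixP=> i j; rewrite !mxE; apply: conj_Creal; apply/complex_realP; exists (M j i).
have hermA : AC \is hermsymmx.
  apply/is_hermitianmxP; rewrite expr0 scale1r conjf symA //.
have /hermitian_normalmx /orthomx_spectralP := hermA.
have sp_real := hermitian_spectral_diag_real hermA.
set P := spectralmx AC; set sp := spectral_diag AC => AE.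
have Punit : P \in unitmx := spectral_unit AC.
have PV : invmx P = P^t* by rewrite invmx_unitary // spectral_unitarymx.
(* A diagonal entry is real and row [i] of [P] is an eigenvector for it, so it descends to an
   eigenvalue of [A] over [R], to which [eigA] applies. *)
have sp_ge i : f b <= sp 0 i.
  have /complex_realP [r Er] : sp 0 i \is Num.real by move/mxOverP: sp_real.
  rewrite Er lecR; apply: eigA; rewrite -(eigenvalue_map f) /= -Er.
  apply/eigenvalueP; exists (row i P).
    rewrite -/AC AE -row_mul mulmxA mulmxA mulmxV // mul1mx.
    by rewrite row_mul row_diag_mx -scalemxAl -rowE.
  apply/eqP=> r0; have: row i (P *m invmx P) = 0 by rewrite row_mul r0 mul0mx.
  rewrite mulmxV // => /rowP/(_ i); rewrite !mxE eqxx => /eqP.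
  by rewrite oner_eq0.
pose w := vC *m invmx P.
have sumE (d : 'rV[R[i]]_n) : (w *m diag_mx d *m w^t*) 0 0 = \sum_i d 0 i * `|w 0 i| ^+ 2.
  rewrite mxE; apply: eq_bigr => i _; rewrite mul_mx_diag !mxE.
  by rewrite mulrAC -normCK mulrC.
have wE : w^t* = P *m vC^t*.
  rewrite /w trmx_mul map_mxM PV; congr (_ *m _).
  by apply/matrixP=> i j; rewrite !mxE; apply: conjCK.
have vv : f ((v *m v^T) 0 0) = \sum_i `|w 0 i| ^+ 2.
  have := sumE (const_mx 1); rewrite diag_const_mx mulmx1 wE /w mulmxA mulmxKV // conjf.
  rewrite -map_mxM mxE => E; apply: (etrans E); apply: eq_bigr => i _.
  by rewrite mxE mul1r.
have vAv : f ((v *m A *m v^T) 0 0) = \sum_i sp 0 i * `|w 0 i| ^+ 2.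
  rewrite -sumE wE /w !mulmxA conjf.
  have -> : vC *m invmx P *m diag_mx sp *m P = vC *m AC by rewrite AE !mulmxA.
  by rewrite -!map_mxM [RHS]mxE.
have fM : f (b * (v *m v^T) 0 0) = f b * f ((v *m v^T) 0 0).
  exact: (rmorphM (real_complex R)).
rewrite -lecR -[X in X <= _]/(f _) -[X in _ <= X]/(f _) fM vv vAv mulr_sumr.
by apply: ler_sum => i _; rewrite ler_wpM2r // exprn_ge0.
Qed.

(** All later test vectors are integral, so the spectral hypothesis is passed on in this form only
    and [R] disappears from the combinatorial part. *)
Lemma adj_form_ge0 (R : rcfType) (T : finType) (e : rel T) (c : nat) :
    symmetric e ->
    (forall a : R, eigenvalue (adjmx e R) a -> - c%:R <= a) ->
  forall g : T -> int, 0 <= \sum_u \sum_v g u * g v * (c * (u == v) + e u v)%N%:Z.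
Proof.
move=> e_sym eigA g.
pose v : 'rV[R]_#|T| := \row_i (g (enum_val i))%:~R.
have symA : (adjmx e R)^T = adjmx e R.
  by apply/matrixP=> i j; rewrite !mxE e_sym.
have := sym_form_ge_eigenvalue symA eigA v.
have -> : (v *m v^T) 0 0 = \sum_u \sum_w (g u * g w * (u == w)%:Z)%:~R.
  rewrite mxE [RHS](reindex_onto enum_val enum_rank) /=; last by move=> u _; exact: enum_rankK.
  rewrite [RHS](eq_bigl xpredT); last by move=> i; rewrite enum_valK eqxx.
  apply: eq_bigr => i _; rewrite (bigD1 (enum_val i)) //= big1 => [|w nw].
    by rewrite !mxE eqxx mulr1 addr0 intrM.
  by rewrite eq_sym (negbTE nw) mulr0.
have -> : (v *m adjmx e R *m v^T) 0 0 = \sum_u \sum_w (g u * g w * (e u w)%:Z)%:~R.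
  rewrite mxE [RHS](reindex_onto enum_val enum_rank) /=; last by move=> u _; exact: enum_rankK.
  rewrite [RHS](eq_bigl xpredT); last by move=> i; rewrite enum_valK eqxx.
  apply: eq_bigr => i _; rewrite [RHS](reindex_onto enum_val enum_rank) /=; last first.
    by move=> u _; exact: enum_rankK.
  rewrite [RHS](eq_bigl xpredT); last by move=> j; rewrite enum_valK eqxx.
  rewrite !mxE mulr_suml; apply: eq_bigr => j _; rewrite !mxE !intrM e_sym.
  by rewrite mulrAC [X in X * _]mulrC.
move=> H; rewrite -(ler0z R) rmorph_sum /=.
have -> : \sum_(i : T) (\sum_(w : T) g i * g w * (c * (i == w) + e i w)%N%:Z)%:~R =
  c%:R * (\sum_(u : T) \sum_(w : T) (g u * g w * (u == w)%:Z)%:~R) +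
  \sum_(u : T) \sum_(w : T) (g u * g w * (e u w)%:Z)%:~R :> R.
  rewrite mulr_sumr -big_split /=; apply: eq_bigr => u _.
  rewrite mulr_sumr -big_split rmorph_sum /=; apply: eq_bigr => w _.
  by rewrite PoszD PoszM !(intrM, intrD) -!pmulrn; ring.
by rewrite -lerBlDl sub0r -mulNr.
Qed.

Section SetForm.
Variables (T : finType) (e : rel T) (c : nat).

(* The adjacency form plus [c] times the identity, at the indicators of [A] and [B]. *)
Definition set_form (A B : {set T}) : nat :=
  c * #|A :&: B| + \sum_(u in A) #|nbhd e u :&: B|.

(** The test vector is the combination of indicator functions listed in [s], and bilinearity expands
    the form into blocks. The sets may overlap. *)
Lemma set_form_ge0 :
    (forall g : T -> int, 0 <= \sum_u \sum_v g u * g v * (c * (u == v) + e u v)%N%:Z) ->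
  forall s : seq (int * {set T}),
    0 <= \sum_(p <- s) \sum_(q <- s) p.1 * q.1 * (set_form p.2 q.2)%:Z.
Proof.
move=> psd s; pose g u := \sum_(p <- s) p.1 * (u \in p.2)%:Z.
have := psd g; congr (_ <= _).
have cardE (A : {set T}) : #|A|%:Z = \sum_u (u \in A)%:Z.
  rewrite -sum1_card big_mkcond /= (big_morph Posz PoszD (erefl _)).
  by apply: eq_bigr => u _; case: (u \in A).
have sfE A B : (set_form A B)%:Z =
    \sum_u \sum_v (u \in A)%:Z * (v \in B)%:Z * (c * (u == v) + e u v)%N%:Z.
  rewrite /set_form PoszD PoszM cardE mulr_sumr (big_morph Posz PoszD (erefl _)).
  rewrite [X in _ + X]big_mkcond -big_split /=.
  apply: eq_bigr => u _; rewrite inE.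
  have -> : \sum_v (u \in A)%:Z * (v \in B)%:Z * (c * (u == v) + e u v)%N%:Z =
      (\sum_v (c * ((u \in A) && (v \in B)))%N%:Z * (u == v)%:Z)
      + (u \in A)%:Z * #|nbhd e u :&: B|%:Z.
    rewrite cardE mulr_sumr -big_split; apply: eq_bigr => v _; rewrite /= !inE.
    by case: (u \in A); case: (v \in B); case: (u == v); case: (e u v) => /=; lia.
  rewrite (bigD1 u) //= big1 ?addr0 => [|v nv].
    by rewrite eqxx mulr1; case: (u \in A) => /=; rewrite ?(mul1r, mul0r, PoszM).
  by rewrite eq_sym (negbTE nv) mulr0.
transitivity (\sum_u \sum_v \sum_(p <- s) \sum_(q <- s)
   p.1 * q.1 * ((u \in p.2)%:Z * (v \in q.2)%:Z * (c * (u == v) + e u v)%N%:Z)).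
  apply: eq_bigr => u _; apply: eq_bigr => v _.
  rewrite /g !mulr_suml; apply: eq_bigr => p _.
  rewrite mulr_sumr mulr_suml; apply: eq_bigr => q _; ring.
under eq_bigr do rewrite exchange_big.
rewrite exchange_big; apply: eq_bigr => p _.
under eq_bigr do rewrite exchange_big.
rewrite exchange_big; apply: eq_bigr => q _.
rewrite sfE mulr_sumr; apply: eq_bigr => u _.
by rewrite mulr_sumr.
Qed.
End SetForm.

End SpectralForm.

Lemma card_subset (T : finType) (A : {set T}) p : p <= #|A| ->
  exists2 B : {set T}, B \subset A & #|B| = p.
Proof.
elim: p => [_|p IH pA]; first by exists set0; rewrite ?sub0set ?cards0.
have [B BA Bp] := IH (ltnW pA).
have /set0Pn[z /setDP[zA zB]] : A :\: B != set0.
  by rewrite -card_gt0 cardsD (setIidPr BA) Bp subn_gt0.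
by exists (z |: B); rewrite ?cardsU1 ?zB ?Bp // subUset sub1set zA.
Qed.

Lemma card_exchange (T : finType) (A B : {set T}) c w :
  w \in B -> A \subset c |: (B :\ w) -> #|A| <= #|B|.
Proof.
move=> wB /subset_leq_card; rewrite cardsU1 (cardsD1 w B) wB.
by case: (c \notin _); lia.
Qed.

Lemma exists_in_contra (T : finType) (P : {set T}) (Q : pred T) :
  ({in P, forall t, ~~ Q t} -> False) -> exists2 t, t \in P & Q t.
Proof.
move=> h; apply/exists_inP; case: (boolP [exists t in P, Q t]) => // nQ; case: h => t tP.
by apply: contraNN nQ => Qt; apply/exists_inP; exists t.
Qed.

(* Boolean hypotheses make [lia] case-split, so only the cardinality facts are kept. *)
Ltac card_facts :=
  repeat match goal with
  | H : is_true (leq _ _) |- _ => revert H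
  | H : @eq nat _ _ |- _ => revert H
  end; clear;
  repeat match goal with |- context [card ?A] => generalize (card A) end; intros.
Ltac card_lia := card_facts; lia.

(** * Lines of the local graphs *)

Definition is_clique (T : finType) (e : rel T) (C : {set T}) : Prop :=
  {in C &, forall u v, u != v -> e u v}.

Definition cliqueb (T : finType) (e : rel T) (C : {set T}) : bool :=
  [forall u in C, forall v in C, (u != v) ==> e u v].

Lemma cliqueP (T : finType) (e : rel T) (C : {set T}) :
  reflect (is_clique e C) (cliqueb e C).
Proof.
apply: (iffP forall_inP) => [h u v uC vC uv|h u uC].
  by have /forall_inP/(_ v vC)/implyP/(_ uv) := h u uC.
by apply/forall_inP=> v vC; apply/implyP; apply: h.
Qed.

(** Maximality is replaced by the consequence that is used: an outside vertex of the local graph has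
    at most one neighbour in [C]. Small sets such as single vertices also qualify. *)
Definition is_line (T : finType) (e : rel T) (x : T) (C : {set T}) : Prop :=
  [/\ C \subset nbhd e x, is_clique e C
    & forall v u w, e x v -> v \notin C -> u \in C -> w \in C ->
        e v u -> e v w -> u = w].

Definition far_nbrs (T : finType) (e : rel T) (x y : T) : {set T} :=
  nbhd e y :\: (x |: nbhd e x).

Section LocalStructure.
Variables (T : finType) (e : rel T) (k l : nat).
Hypotheses (e_sym : symmetric e) (e_irr : irreflexive e).
Hypothesis reg : regular_graph e k.
Hypothesis mu2 : forall x y : T, x != y -> ~~ e x y -> #|common_nbrs e x y| = 2.
Hypothesis strong : forall x z : T, x != z -> ~~ e x z ->
  \sum_(y in common_nbrs e x z) #|common_nbrs e x y| = l.

Local Notation N := (nbhd e).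
Local Notation a x y := #|common_nbrs e x y|.
Local Notation line := (is_line e).

Lemma in_common z x y : (z \in common_nbrs e x y) = e x z && e y z.
Proof. by rewrite !inE. Qed.

Lemma common_nbrsC x y : common_nbrs e x y = common_nbrs e y x.
Proof. exact: setIC. Qed.

Lemma adj_neq x y : e x y -> x != y.
Proof. by apply: contraTneq => ->; rewrite e_irr. Qed.

Lemma common_nbrs_at_most2 x z u v w :
  x != z -> ~~ e x z -> e x u -> e z u -> e x v -> e z v -> e x w -> e z w ->
  u != v -> u != w -> v != w -> False.
Proof.
move=> xz nxz xu zu xv zv xw zw uv uw vw.
have sub : [set u; v; w] \subset common_nbrs e x z.
  apply/subsetP=> t; rewrite in_common !inE -orbA.
  by case/or3P=> /eqP->; apply/andP.
have := subset_leq_card sub; rewrite mu2 // setUC cardsU1 cards2 !inE uv.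
by rewrite ![w == _]eq_sym (negbTE uw) (negbTE vw).
Qed.

Lemma strong_pair x z u v :
  x != z -> ~~ e x z -> u != v -> e x u -> e z u -> e x v -> e z v ->
  a x u + a x v = l.
Proof.
move=> xz nxz uv xu zu xv zv; rewrite -(strong xz nxz).
have -> : common_nbrs e x z = [set u; v].
  apply/esym/eqP; rewrite eqEcard mu2 // cards2 uv andbT.
  by apply/subsetP=> t; rewrite in_common !inE; case/orP=> /eqP->; apply/andP.
by rewrite big_setU1 ?inE //= big_set1.
Qed.

Lemma far_pair x y z :
  e x y -> e x z -> y != z -> ~~ e y z ->
  (forall v, e x v -> e y v -> e z v -> False) -> a x y + a x z = l.
Proof.
move=> xy xz yz nyz far.
have : common_nbrs e y z :\ x != set0.
  rewrite -card_gt0; have := cardsD1 x (common_nbrs e y z).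
  by rewrite mu2 // in_common ![e _ x]e_sym xy xz => /eqP; rewrite eqSS => /eqP <-.
case/set0Pn=> w; rewrite in_setD1 in_common => /and3P[wx yw zw].
apply: (@strong_pair x w); rewrite // 1?eq_sym // 1?[e w _]e_sym //.
by apply/negP=> xw; apply: (far w).
Qed.

Lemma near_pair x y z c :
  e x y -> e x z -> e x c -> y != z -> ~~ e y z -> e y c -> e z c ->
  a x y + a c y = l.
Proof.
move=> xy xz xc yz nyz yc zc; rewrite ![common_nbrs e _ y]common_nbrsC.
by apply: (@strong_pair y z); rewrite // 1?[e _ x]e_sym //; apply: adj_neq.
Qed.

(** An inclusion-maximal clique is a line: if [v] outside it had two neighbours [u], [w] in it,
    maximality would give [t] in the clique not adjacent to [v], and [v], [t] would share [x], [u],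
    [w]. *)
Lemma clique_sub_line x (D : {set T}) :
  D \subset N x -> is_clique e D -> exists2 C, line x C & D \subset C.
Proof.
move=> DN cD.
pose P (C : {set T}) := (C \subset N x) && cliqueb e C.
have PP C : P C -> is_clique e C by case/andP=> _ /cliqueP.
have PD : P D by rewrite /P DN; apply/cliqueP.
have [C /maxsetP[PC maxC] DC] := maxset_exists PD.
exists C => //; split; [by case/andP: PC | exact: PP |].
move=> v u w xv vC uC wC vu vw; apply/eqP/idPn=> uw.
have [t tC nvt] : exists2 t, t \in C & ~~ e v t.
  case: (boolP [forall t in C, e v t]) => [/forall_inP vadj|]; last first.
    by rewrite negb_forall_in => /exists_inP.
  suff PvC : P (v |: C) by case/negP: vC; rewrite -(maxC _ PvC) ?subsetUr // setU11.
  rewrite /P subUset sub1set inE xv; case/andP: (PC) => -> _ /=.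
  apply/cliqueP=> p q /setU1P[->|pC] /setU1P[->|qC]; rewrite ?eqxx //.
  - by move=> _; apply: vadj.
  - by move=> _; rewrite e_sym; apply: vadj.
  - by move=> pq; apply: (PP C PC).
have vt : v != t by apply: contraNneq vC => ->.
have CN s : s \in C -> e x s.
  by case/andP: PC => /subsetP h _ /h; rewrite inE.
have ut : u != t by apply: contraTneq vu => ->.
have wt : w != t by apply: contraTneq vw => ->.
apply: (@common_nbrs_at_most2 v t x u w) => //; rewrite 1?[e _ x]e_sym //.
- exact: CN.
- by rewrite eq_sym in ut; apply: (PP C PC).
- by rewrite eq_sym in wt; apply: (PP C PC).
- by apply: adj_neq; apply: CN.
- by apply: adj_neq; apply: CN.
Qed.

Section AtVertex.
Variable x : T.

Lemma line_adj C y : line x C -> y \in C -> e x y.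
Proof. by case=> /subsetP h _ _ /h; rewrite inE. Qed.

Lemma line_clique C u v : line x C -> u \in C -> v \in C -> u != v -> e u v.
Proof. by case=> _ h _; apply: h. Qed.

(** If [y] and [y'] differ, then [y] and [z'] are not adjacent, since [z'] has only one neighbour in
    [C]; yet they share [x], [y'] and [z]. The vertex [y] may lie in [C'], so a common vertex of
    both lines counts as an end of bridges. *)
Lemma line_bridge_uniq C C' y y' z z' :
  line x C -> line x C' -> y \in C -> y' \in C -> z \in C' :\: C -> z' \in C' :\: C ->
  e y z -> e y' z' -> y = y'.
Proof.
move=> lC lC' yC y'C /setDP[zC' zC] /setDP[z'C' z'C] yz y'z'.
apply/eqP/idPn=> yy'; have [_ _ lC3] := lC.
have zz' : z != z'.
  apply: contraNneq yy' => zz'; apply/eqP.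
  by apply: (lC3 z); rewrite // 1?[e z _]e_sym ?(line_adj lC') // zz'.
have nyz' : ~~ e y z'.
  apply: contraNN yy' => yz'; apply/eqP.
  by apply: (lC3 z'); rewrite // 1?[e z' _]e_sym ?(line_adj lC').
apply: (@common_nbrs_at_most2 y z' x y' z) => //.
- by apply: contraNneq z'C => <-.
- by rewrite e_sym (line_adj lC).
- by rewrite e_sym (line_adj lC').
- by apply: (line_clique lC).
- by rewrite e_sym.
- by apply: (line_clique lC'); rewrite // eq_sym.
- by apply: adj_neq; apply: (line_adj lC).
- by apply: adj_neq; apply: (line_adj lC').
- by apply: contraNneq zC => <-.
Qed.

Lemma line_deg_ge C y : line x C -> y \in C -> #|C| <= (a x y).+1.
Proof.
move=> lC yC; rewrite (cardsD1 y C) yC add1n ltnS subset_leq_card //.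
apply/subsetP=> z /setD1P[zy zC]; rewrite in_common (line_adj lC zC).
by apply: (line_clique lC); rewrite // eq_sym.
Qed.

Lemma line_deg_eq C y :
  line x C -> y \in C -> (forall z, e x z -> e y z -> z \in C) -> (a x y).+1 = #|C|.
Proof.
move=> lC yC fr; apply/eqP; rewrite eqn_leq line_deg_ge // andbT.
rewrite (cardsD1 y C) yC add1n ltnS subset_leq_card //.
apply/subsetP=> z; rewrite in_common => /andP[xz yz].
by rewrite in_setD1 fr // andbT eq_sym adj_neq.
Qed.

Lemma line_pair_deg_ge C c y :
  line x C -> c \in C -> y \in C -> c != y -> #|C| <= (a c y).+1.
Proof.
move=> lC cC yC cy.
have sub : x |: (C :\ c :\ y) \subset common_nbrs e c y.
  apply/subsetP=> z /setU1P[->|]; rewrite in_common.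
    by rewrite ![e _ x]e_sym !(line_adj lC).
  case/setD1P=> zy /setD1P[zc zC].
  by rewrite !(line_clique lC) // eq_sym.
have := subset_leq_card sub; rewrite cardsU1.
have -> : x \notin C :\ c :\ y.
  by apply/negP=> /setD1P[_ /setD1P[_ /(line_adj lC)]]; rewrite e_irr.
have := cardsD1 c C; have := cardsD1 y (C :\ c).
by rewrite cC !inE yC eq_sym cy /= => -> ->; rewrite !add1n.
Qed.

Lemma card_far_nbrs y : e x y -> (#|far_nbrs e x y| + a x y).+1 = k.
Proof.
move=> xy; rewrite -(reg y) -(cardsID (x |: N x) (N y)) addnC -addSn; congr addn.
have -> : N y :&: (x |: N x) = x |: common_nbrs e x y.
  apply/setP=> z; rewrite !inE; case: eqVneq => [->|_] /=; last by rewrite andbC.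
  by rewrite andbT e_sym.
by rewrite cardsU1 in_common e_irr.
Qed.

(** Double count of the edges from a neighbour [y] to a non-neighbour [z] of [x], each weighted by
    [w y]. *)
Lemma sum_far_nbrs (w : T -> nat) :
  \sum_(y in N x) w y * #|far_nbrs e x y| =
  \sum_(z in ~: (x |: N x)) \sum_(y in common_nbrs e x z) w y.
Proof.
rewrite (exchange_big_dep (mem (N x))) /=; last by move=> z y _; rewrite in_common inE => /andP[].
apply: eq_bigr => y; rewrite inE => xy; rewrite sum_nat_const mulnC; congr muln.
by apply: eq_card => z; rewrite !inE unfold_in /= !inE xy /= [e z y]e_sym.
Qed.

Lemma non_nbrs_common z : z \in ~: (x |: N x) -> x != z /\ ~~ e x z.
Proof. by rewrite !inE negb_or eq_sym => /andP[]. Qed.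

Lemma sum_card_far_nbrs :
  \sum_(y in N x) #|far_nbrs e x y| = 2 * #|~: (x |: N x)|.
Proof.
have := sum_far_nbrs (fun=> 1); under eq_bigr do rewrite mul1n.
move=> ->; under eq_bigr => z /non_nbrs_common[xz nxz].
  rewrite sum1_card mu2 //; over.
by rewrite sum_nat_const mulnC.
Qed.

(** Each non-neighbour [z] of [x] contributes 2 to the number of edges leaving [N x] and [l] to the
    sum of [a x y] over them. So the average of [a x y] over these edges is [l / 2]. *)
Lemma far_nbrs_average :
  l * (\sum_(y in N x) #|far_nbrs e x y|) =
  2 * \sum_(y in N x) a x y * #|far_nbrs e x y|.
Proof.
rewrite sum_card_far_nbrs sum_far_nbrs.
under [X in _ = 2 * X]eq_bigr => z /non_nbrs_common[xz nxz].
  rewrite strong //; over.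
by rewrite sum_nat_const; ring.
Qed.

Lemma card_T_nbrs : #|T| = k.+1 + #|~: (x |: N x)|.
Proof.
by rewrite -(cardsC (x |: N x)) cardsU1 inE e_irr reg.
Qed.

End AtVertex.

Hypothesis not_complete : ~ complete_graph e.

(** If [N x] is a clique, a neighbour [y] of [x] already has [k] neighbours in [x |: N x], so no
    vertex is at distance two from [x]. By [mu2] every non-neighbour would be, so the graph would be
    complete. *)
Lemma nbhd_not_clique x : ~ is_clique e (N x).
Proof.
move=> cN; apply: not_complete.
have adjx z : z != x -> e x z.
  move=> zx; apply/idPn=> nxz.
  have : common_nbrs e x z != set0 by rewrite -card_gt0 mu2 // eq_sym.
  case/set0Pn=> y; rewrite in_common => /andP[xy zy].
  have sub : x |: (N x :\ y) \subset N y.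
    apply/subsetP=> t /setU1P[->|/setD1P[ty]]; rewrite inE; first by rewrite e_sym.
    by rewrite inE => xt; apply: cN; rewrite ?inE // eq_sym.
  have /eqP E : x |: (N x :\ y) == N y.
    rewrite eqEcard sub cardsU1 !inE e_irr andbF /= add1n.
    by have := cardsD1 y (N x); rewrite inE xy !reg add1n => <-.
  have : z \in N y by rewrite inE e_sym.
  by rewrite -E !inE (negbTE zx) (negbTE nxz) andbF.
move=> u v uv.
have [uE|ux] := eqVneq u x; first by rewrite uE adjx // -uE eq_sym.
have [vE|vx] := eqVneq v x; first by rewrite vE e_sym adjx // -vE.
by apply: cN; rewrite // inE adjx.
Qed.

Definition locally_two_cliques x : Prop :=
  exists C D : {set T}, [/\ N x = C :|: D, is_clique e C, is_clique e D,
    C != set0 /\ D != set0 & {in C & D, forall u v, u != v /\ ~~ e u v}].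

(* A bridge from the line [C] to [w] outside it would give
   [2 (#|C| - 1) <= l <= 2 #|W|] by [near_pair] at both of its ends.  Without
   bridges [far_pair] makes [a x] constant on [W], and then [far_nbrs_average]
   forces [W] to be a clique. *)
Section HugeLine.
Variables (x : T) (C : {set T}).
Hypotheses (lC : line x C) (hugeC : k.+1 < 2 * #|C|).

Let W := N x :\: C.

Lemma huge_card : #|C| + #|W| = k.
Proof.
have [sub _ _] := lC; rewrite -(reg x) -(cardsID C (N x)); congr addn.
by rewrite (setIidPr sub).
Qed.

Lemma huge_no_bridge w c : w \in W -> c \in C -> ~~ e w c.
Proof.
case/setDP; rewrite inE => xw wC cC; apply/negP=> wc; have cardE := huge_card.
have [_ _ lC3] := lC.
have : C :\ c != set0.
  by rewrite -card_gt0; have := cardsD1 c C; rewrite cC; card_lia.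
case/set0Pn=> y /setD1P[yc yC].
have xc := line_adj lC cC; have xy := line_adj lC yC.
have nwy : ~~ e w y.
  by apply: contraNN yc => wy; apply/eqP; apply: (lC3 w).
have cy : e c y by apply: (line_clique lC); rewrite // eq_sym.
have yw : y != w by apply: contraNneq wC => <-.
have E1 : a x y + a c y = l.
  by apply: (@near_pair x y w c); rewrite // 1?[e y c]e_sym // e_sym.
have E2 : a x w + a c w = l by apply: (@near_pair x w y c); rewrite // 1?eq_sym // e_sym.
have B1 := line_deg_ge lC yC.
have B2 : #|C| <= (a c y).+1 by apply: (line_pair_deg_ge lC); rewrite // eq_sym.
have wW : w \in W by rewrite !inE wC.
(* As [c] is the only neighbour of [w] in [C], the common neighbours of [x] and [w] lie in [W] with
   [w] exchanged for [c]. *)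
have B3 : a x w <= #|W|.
  apply: (@card_exchange _ _ _ c w) => //.
  apply/subsetP=> z; rewrite in_common => /andP[xz wz]; rewrite !inE xz andbT.
  case zC: (z \in C); last by rewrite orbC eq_sym adj_neq.
  by rewrite (lC3 w z c) ?eqxx.
(* The same exchange at [c], which by regularity has at most [#|W|] neighbours outside [x |: C]: now
   [w] is exchanged for [x]. *)
have B4 : a c w <= #|W|.
  have cN : #|N c :\: (x |: C)| <= #|W|.
    have := cardsID (x |: C) (N c); rewrite reg.
    have : #|x |: (C :\ c)| <= #|N c :&: (x |: C)|.
      apply: subset_leq_card; apply/subsetP=> z /setU1P[->|/setD1P[zc zC]].
        by rewrite !inE eqxx e_sym xc.
      by rewrite !inE zC orbT andbT; apply: (line_clique lC); rewrite // eq_sym.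
    have xC : x \notin C by apply/negP=> /(line_adj lC); rewrite e_irr.
    by rewrite cardsU1 !inE (negbTE xC) andbF /=; have := cardsD1 c C; rewrite cC; card_lia.
  apply: leq_trans cN; apply: (@card_exchange _ _ _ x w).
    by rewrite !inE (negbTE wC) eq_sym (negbTE (adj_neq xw)) e_sym wc.
  apply/subsetP=> z; rewrite in_common => /andP[cz wz]; rewrite !inE cz.
  have [->//|zx /=] := eqVneq z x.
  rewrite andbT [z == w]eq_sym (adj_neq wz) /=.
  by apply/negP=> zC; have := adj_neq cz; rewrite (lC3 w c z) ?eqxx.
by move: hugeC; card_lia.
Qed.

Lemma huge_line_two_cliques : l.+2 = k /\ locally_two_cliques x.
Proof.
have cardE := huge_card; have nb := huge_no_bridge.
have aC y : y \in C -> (a x y).+1 = #|C|.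
  move=> yC; apply: (line_deg_eq lC) => // z xz yz; apply/idPn=> zC.
  by have := nb z y; rewrite !inE zC xz yC e_sym yz => /(_ isT isT).
have [sub cC lC3] := lC.
have [y0 y0C] : exists y, y \in C.
  by apply/set0Pn; rewrite -card_gt0; move: hugeC; card_lia.
have aW w : w \in W -> a x w + #|C| = l.+1.
  move=> wW; rewrite -(aC _ y0C) addnS addnC; congr S.
  case/setDP: (wW); rewrite inE => xw wC.
  apply: far_pair => //; first exact: (line_adj lC).
  - by apply: contraNneq wC => <-.
  - by rewrite e_sym; apply: nb.
  move=> v xv y0v wv; case vC: (v \in C).
    by have := nb w v wW vC; rewrite wv.
  by have := nb v y0; rewrite !inE vC xv y0C e_sym y0v => /(_ isT isT).
have W_sub w : w \in W -> common_nbrs e x w \subset W :\ w.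
  move=> wW; apply/subsetP=> z; rewrite in_common => /andP[xz wz].
  rewrite !inE xz andbT eq_sym (adj_neq wz) /=.
  by apply/negP=> zC; have := nb w z wW zC; rewrite wz.
have [w0 w0W] : exists w, w \in W.
  apply/set0Pn/eqP=> W0; apply: (@nbhd_not_clique x) => u v uN vN.
  have NC z : z \in N x -> z \in C.
    by move=> zN; apply: contraTT isT => zC; have := in_set0 z; rewrite -W0 inE zC zN.
  by apply: cC; apply: NC.
have d_lt w : w \in W -> a x w < #|W|.
  move=> wW; have := subset_leq_card (W_sub w wW).
  by rewrite (cardsD1 w W) wW add1n ltnS.
have avg := far_nbrs_average x.
have farC y : y \in C -> #|far_nbrs e x y| = #|W|.
  by move=> yC; have := card_far_nbrs (line_adj lC yC); have := aC y yC; card_lia.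
have farW w : w \in W -> #|far_nbrs e x w| = k - (a x w0).+1.
  move=> wW; have xw : e x w by move: wW; rewrite !inE => /andP[].
  by have := card_far_nbrs xw; have := aW w wW; have := aW w0 w0W; card_lia.
have aWW w : w \in W -> a x w = a x w0.
  by move=> wW; have := aW w wW; have := aW w0 w0W; card_lia.
have split_sum (F : T -> nat) : \sum_(y in N x) F y = \sum_(y in C) F y + \sum_(y in W) F y.
  by rewrite (big_setID C) /= (setIidPr sub).
have s1 : \sum_(y in N x) #|far_nbrs e x y| = #|C| * #|W| + #|W| * (k - (a x w0).+1).
  by rewrite split_sum (eq_bigr _ farC) (eq_bigr _ farW) !sum_nat_const.
have s2 : \sum_(y in N x) a x y * #|far_nbrs e x y| =
    #|C| * (#|C|.-1 * #|W|) + #|W| * (a x w0 * (k - (a x w0).+1)).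
  rewrite split_sum; congr addn.
    rewrite (eq_bigr (fun=> #|C|.-1 * #|W|)) ?sum_nat_const // => y yC.
    by rewrite farC // -(aC y).
  rewrite (eq_bigr (fun=> a x w0 * (k - (a x w0).+1))) ?sum_nat_const // => w wW.
  by rewrite farW // aWW.
have d0 := d_lt w0 w0W; have l0 := aW w0 w0W.
(* With [s = s' + 1] and [t = d + 1 + q] the average identity collapses to [s' * q = d * q]. Since
   [C] has more than half of the vertices, [d < s'], so [q = 0]. *)
have full : (a x w0).+1 = #|W|.
  move: avg; rewrite s1 s2; move: hugeC d0 l0 cardE.
  move: #|C| #|W| (a x w0) => s t d hs dt ld st avg.
  have [s' Es] : exists s', s = s'.+1 by exists s.-1; card_lia.
  have [q Et] : exists q, t = d.+1 + q by exists (t - d.+1); card_lia.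
  have El : l = d + s' by card_lia.
  have Ek : k - d.+1 = s'.+1 + q by card_lia.
  rewrite Ek Es El /= in avg.
  have /eqP : t * (s' * q) = t * (d * q) by card_lia.
  by rewrite eqn_pmul2l ?eqn_mul2r; [case/orP=> /eqP|]; card_lia.
split; first card_lia.
exists C, W; split=> //.
- by rewrite -(setIidPr sub) setID.
- move=> u v uW vW uv.
  have : common_nbrs e x u = W :\ u.
    apply/eqP; rewrite eqEcard W_sub //= aWW //.
    by have := cardsD1 u W; rewrite uW; card_lia.
  move/setP/(_ v); rewrite in_common in_setD1 vW eq_sym uv /=.
  by case/andP.
- by split; apply/set0Pn; [exists y0 | exists w0].
move=> u v uC vW; split; last by rewrite e_sym; apply: nb.
by apply: contraTneq vW => <-; rewrite !inE uC.
Qed.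

End HugeLine.

(** * Test vectors *)

Hypothesis psd : forall s : seq (int * {set T}),
  (0 <= \sum_(p <- s) \sum_(q <- s) p.1 * q.1 * (set_form e 3 p.2 q.2)%:Z)%R.

Definition apart (A B : {set T}) : Prop := {in A & B, forall u v, u != v /\ ~~ e u v}.

Local Notation qf := (set_form e 3).

Lemma apart_disjoint A B : apart A B -> A :&: B = set0.
Proof.
move=> ap; apply/setP=> z; rewrite !inE; apply/negP=> /andP[zA zB].
by have [] := ap z z zA zB; rewrite eqxx.
Qed.

Lemma set_formC A B : qf A B = qf B A.
Proof.
rewrite /set_form setIC; congr addn.
have E (u : T) (D : {set T}) : #|N u :&: D| = \sum_(v in D) e u v.
  rewrite -sum1_card [RHS]big_mkcond /= [LHS]big_mkcond /=.
  by apply: eq_bigr => v _; rewrite !inE; case: (v \in D); case: (e u v).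
under eq_bigr do rewrite E; rewrite exchange_big /=.
by apply: eq_bigr => v _; rewrite E; apply: eq_bigr => u _; rewrite e_sym.
Qed.

Lemma set_form_clique C : is_clique e C -> qf C C = #|C| * (#|C| + 2).
Proof.
move=> cC; rewrite /set_form setIid (eq_bigr (fun=> #|C|.-1)) => [|u uC].
  by rewrite sum_nat_const; case: #|C| => [|s] /=; card_lia.
have -> : N u :&: C = C :\ u.
  apply/setP=> v; rewrite !inE; have [->|vu] := eqVneq v u; first by rewrite e_irr.
  by case vC: (v \in C); rewrite ?andbF // andbT; apply: cC; rewrite // eq_sym.
by rewrite (cardsD1 u C) uC.
Qed.

Lemma set_form_self_le (W : {set T}) d :
  {in W, forall w, #|N w :&: W| <= d} -> qf W W <= #|W| * (d + 3).
Proof.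
move=> dW; rewrite /set_form setIid mulnDr addnC [#|W| * 3]mulnC leq_add2r.
by rewrite -sum_nat_const; apply: leq_sum.
Qed.

Lemma set_form_cross_le (W D : {set T}) r :
  {in W, forall w, w \notin D /\ #|N w :&: D| <= r} -> qf W D <= #|W| * r.
Proof.
move=> h; rewrite /set_form (_ : W :&: D = set0); last first.
  by apply/setP=> z; rewrite !inE; apply/negP=> /andP[/h[/negP]].
rewrite cards0 muln0 add0n -sum_nat_const; apply: leq_sum => w /h[] //.
Qed.

Lemma set_form_apart A B : apart A B -> qf A B = 0.
Proof.
move=> ap; apply/eqP; rewrite -leqn0.
apply: (@leq_trans (#|A| * 0)); last by rewrite muln0.
apply: set_form_cross_le => u uA.
split; first by apply/negP=> uB; have [] := ap u u uA uB; rewrite eqxx.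
rewrite leqn0 cards_eq0; apply/eqP/setP=> v; rewrite !inE.
by apply/negP=> /andP[uv vB]; have [_] := ap u v uA vB; rewrite uv.
Qed.

Lemma set_form_center (X D : {set T}) :
  {in X & D, forall y z, e y z} -> qf X D = #|X| * #|D|.
Proof.
move=> h; rewrite /set_form (_ : X :&: D = set0); last first.
  by apply/setP=> z; rewrite !inE; apply/negP=> /andP[zX zD]; have := h z z zX zD; rewrite e_irr.
rewrite cards0 muln0 add0n -sum_nat_const; apply: eq_bigr => y yX; congr #|pred_of_set _|.
by apply/setIidPr/subsetP=> z zD; rewrite inE; apply: h.
Qed.

(* The test vector is [-xi] on [x], [a_i] on the cliques [D_i] and [b] on [W].
   The weights chosen below are roundings of multiples of [1 / (#|D_i| + 2)] and
   [1 / (d + 3)], with [xi] about a third of the total weight, which minimizes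
   the form. *)
Lemma star_test x (D1 D2 D3 W : {set T}) d r (xi a1 a2 a3 b : nat) :
    D1 \subset N x -> D2 \subset N x -> D3 \subset N x -> W \subset N x ->
    is_clique e D1 -> is_clique e D2 -> is_clique e D3 ->
    apart D1 D2 -> apart D1 D3 -> apart D2 D3 ->
    {in W, forall w, #|N w :&: W| <= d} ->
    {in W, forall w, w \notin D1 /\ #|N w :&: D1| <= r} ->
    {in W, forall w, w \notin D2 /\ #|N w :&: D2| <= r} ->
    {in W, forall w, w \notin D3 /\ #|N w :&: D3| <= r} ->
  2 * xi * (a1 * #|D1| + a2 * #|D2| + a3 * #|D3| + b * #|W|) <=
    3 * xi * xi + a1 * a1 * #|D1| * (#|D1| + 2) + a2 * a2 * #|D2| * (#|D2| + 2)
    + a3 * a3 * #|D3| * (#|D3| + 2) + b * b * #|W| * (d + 3)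
    + 2 * b * #|W| * r * (a1 + a2 + a3).
Proof.
move=> s1 s2 s3 sW c1 c2 c3 ap12 ap13 ap23 dW w1 w2 w3.
have cen (D : {set T}) : D \subset N x -> qf [set x] D = #|D|.
  move=> /subsetP DN; rewrite set_form_center ?cards1 ?mul1n // => y z.
  by rewrite inE => /eqP-> /DN; rewrite inE.
have := psd [:: (- xi%:Z, [set x]); (a1%:Z, D1); (a2%:Z, D2); (a3%:Z, D3); (b%:Z, W)]%R.
rewrite !big_cons !big_nil /= !addr0.
rewrite (set_formC D1 [set x]) (set_formC D2 [set x]) (set_formC D3 [set x]).
rewrite (set_formC W [set x]) (cen _ s1) (cen _ s2) (cen _ s3) (cen _ sW).
rewrite (set_formC D2 D1) (set_formC D3 D1) (set_formC D3 D2).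
rewrite (set_formC D1 W) (set_formC D2 W) (set_formC D3 W).
rewrite (set_form_apart ap12) (set_form_apart ap13) (set_form_apart ap23).
have cx : is_clique e [set x] by move=> u v; rewrite !inE => /eqP-> /eqP->; rewrite eqxx.
rewrite (set_form_clique cx) (set_form_clique c1) (set_form_clique c2) (set_form_clique c3).
have := set_form_self_le dW; have := set_form_cross_le w1.
have := set_form_cross_le w2; have := set_form_cross_le w3; rewrite cards1.
move: (qf W W) (qf W D1) (qf W D2) (qf W D3) => qW q1 q2 q3 h3 h2 h1 hW hpsd.
have m1 : b * a1 * q1 <= b * a1 * (#|W| * r) by rewrite leq_mul2l h1 orbT.
have m2 : b * a2 * q2 <= b * a2 * (#|W| * r) by rewrite leq_mul2l h2 orbT.
have m3 : b * a3 * q3 <= b * a3 * (#|W| * r) by rewrite leq_mul2l h3 orbT.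
have mW : b * b * qW <= b * b * (#|W| * (d + 3)) by rewrite leq_mul2l hW orbT.
by move: hpsd m1 m2 m3 mW; move: #|D1| #|D2| #|D3| #|W|; card_lia.
Qed.

(** The analogue of [star_test] centred at an edge, with weight [-xi] on both ends: the form at the
    two ends alone is [8 * xi * xi], and every other vertex of the support is joined to both of
    them. *)
Lemma edge_test x c (D1 D2 W : {set T}) d (xi a1 a2 b : nat) :
    e x c -> D1 \subset common_nbrs e x c -> D2 \subset common_nbrs e x c ->
    W \subset common_nbrs e x c -> is_clique e D1 -> is_clique e D2 ->
    apart D1 D2 -> apart D1 W -> apart D2 W ->
    {in W, forall w, #|N w :&: W| <= d} ->
  4 * xi * (a1 * #|D1| + a2 * #|D2| + b * #|W|) <=
    8 * xi * xi + a1 * a1 * #|D1| * (#|D1| + 2) + a2 * a2 * #|D2| * (#|D2| + 2)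
    + b * b * #|W| * (d + 3).
Proof.
move=> xc s1 s2 sW c1 c2 ap12 ap1W ap2W dW.
have X2 : #|[set x; c]| = 2 by rewrite cards2 adj_neq.
have cen (D : {set T}) : D \subset common_nbrs e x c -> qf [set x; c] D = 2 * #|D|.
  move=> /subsetP DN; rewrite set_form_center ?X2 // => y z.
  by rewrite !inE => /orP[] /eqP-> /DN; rewrite in_common => /andP[].
have cX : is_clique e [set x; c].
  move=> u v; rewrite !inE => /orP[] /eqP-> /orP[] /eqP->; rewrite ?eqxx //.
  by rewrite e_sym.
have := psd [:: (- xi%:Z, [set x; c]); (a1%:Z, D1); (a2%:Z, D2); (b%:Z, W)]%R.
rewrite !big_cons !big_nil /= !addr0.
rewrite (set_formC D1 [set x; c]) (set_formC D2 [set x; c]) (set_formC W [set x; c]).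
rewrite (cen _ s1) (cen _ s2) (cen _ sW) (set_formC D2 D1) (set_formC W D1) (set_formC W D2).
rewrite (set_form_apart ap12) (set_form_apart ap1W) (set_form_apart ap2W).
rewrite (set_form_clique cX) (set_form_clique c1) (set_form_clique c2) X2.
have := set_form_self_le dW; move: (qf W W) => qW hW hpsd.
have mW : b * b * qW <= b * b * (#|W| * (d + 3)) by rewrite leq_mul2l hW orbT.
by move: hpsd mW; move: #|D1| #|D2| #|W|; card_lia.
Qed.

(** * Clearing lines of bridges, and the inequalities for what remains *)

Definition few_bridges (C C' : {set T}) : Prop := forall y y' z z',
  y \in C -> y' \in C -> z \in C' :\: C -> z' \in C' :\: C ->
  e y z -> e y' z' -> y = y'.

Lemma line_few_bridges x C C' : line x C -> line x C' -> few_bridges C C'.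
Proof. by move=> lC lC' y y' z z' *; apply: (@line_bridge_uniq x C C' y y' z z'). Qed.

Lemma vertex_few_bridges x C w : line x C -> e x w -> few_bridges C [set w].
Proof.
move=> [_ _ lC3] xw y y' z z' yC y'C /setDP[/set1P-> wC] /setDP[/set1P-> _] yw y'w.
by apply: (lC3 w); rewrite // e_sym.
Qed.

(** Each member of [Cs] has its bridges at a single vertex of [C], so clearing them costs at most
    one vertex per member. *)
Lemma free_part C (Cs : seq {set T}) p :
  (forall C', C' \in Cs -> few_bridges C C') -> p + size Cs <= #|C| ->
  exists D : {set T}, [/\ D \subset C, #|D| = p &
    forall C' y z, C' \in Cs -> y \in D -> z \in C' :\: C -> ~~ e y z].
Proof.
elim: Cs p => [|C' Cs IH] p fb /=.
  rewrite addn0 => /card_subset[D DC Dp]; exists D; split=> //.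
rewrite addnS -addSn => pC.
have [E [EC Ep Efree]] := IH p.+1 (fun D hD => fb D (mem_behead (s := C' :: Cs) hD)) pC.
pose B := [set y in E | [exists z in C' :\: C, e y z]].
have B1 : #|B| <= 1.
  apply/card_le1_eqP=> y y'; rewrite !inE => /andP[yE /exists_inP[z zC yz]].
  case/andP=> y'E /exists_inP[z' z'C yz'].
  by apply: (fb C' (mem_head _ _) y' y z' z) => //; apply: (subsetP EC).
have : p <= #|E :\: B|.
  have := cardsID B E; rewrite Ep; have := subset_leq_card (subsetIr E B); card_lia.
case/card_subset=> D /subsetP DE Dp; exists D; split=> //.
  by apply/subsetP=> z /DE /setDP[/(subsetP EC)].
move=> C'' y z; rewrite inE => /orP[/eqP->|hC''] yD zC; have /setDP[yE yB] := DE y yD.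
  by apply: contraNN yB => yz; rewrite inE yE; apply/exists_inP; exists z.
exact: (Efree C'').
Qed.

(** Clearing also removes a common vertex of the two lines: by the non-inclusions it would be
    adjacent to a vertex of [C'] outside [C]. *)
Lemma free_parts_apart x C C' (D D' : {set T}) :
    line x C -> line x C' -> ~~ (C \subset C') -> ~~ (C' \subset C) ->
    D \subset C -> D' \subset C' ->
    (forall y z, y \in D -> z \in C' :\: C -> ~~ e y z) ->
    (forall y z, y \in D' -> z \in C :\: C' -> ~~ e y z) -> apart D D'.
Proof.
move=> lC lC' /subsetPn[p pC pC'] /subsetPn[q qC' qC] /subsetP DC /subsetP D'C' fD fD' u v uD vD'.
have uC := DC u uD; have vC' := D'C' v vD'.
have uC' : u \notin C'.
  apply/negP=> uC'; have := fD u q uD; rewrite !inE qC' qC => /(_ isT)/negP; apply.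
  by apply: (line_clique lC') => //; apply: contraTneq uC => ->.
split; first by apply: contraNneq uC' => ->.
by rewrite e_sym; apply: fD'; rewrite // !inE uC uC'.
Qed.

Lemma line_cross x C (D : {set T}) w :
  line x C -> D \subset C -> e x w -> w \notin C -> w \notin D /\ #|N w :&: D| <= 1.
Proof.
move=> [_ _ lC3] /subsetP DC xw wC; split; first by apply: contraNN wC => /DC.
apply/card_le1_eqP=> u v; rewrite !inE => /andP[wu /DC uC] /andP[wv /DC vC].
exact: (lC3 w).
Qed.

Definition clique_free (W : {set T}) (m : nat) : Prop :=
  forall D : {set T}, D \subset W -> is_clique e D -> #|D| < m.

(** Let [D] be the neighbours of [y] in [W]. For [z] in [D], the set [N z :&: D] is a clique, as two
    non-adjacent members would share [x], [y], [z]; adding [y] and [z] gives a clique in [W], so it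
    has at most 7 vertices. The edge test on [D] with [xi = #|D|] and [b = 4] then reads
    [16 d^2 <= 8 d^2 + 160 d] for [d = #|D|]. *)
Lemma clique_free_deg x (W : {set T}) y :
  W \subset N x -> clique_free W 10 -> y \in W -> #|N y :&: W| <= 20.
Proof.
move=> /subsetP WN cfW yW; set D := N y :&: W.
have xy : e x y by have := WN y yW; rewrite inE.
have DN z : z \in D -> e x z /\ e y z.
  by rewrite !inE => /andP[yz /WN]; rewrite inE.
have sub : D \subset common_nbrs e x y.
  by apply/subsetP=> z /DN[xz yz]; rewrite in_common xz.
have dD : {in D, forall z, #|N z :&: D| <= 7}.
  move=> z zD; have [xz yz] := DN z zD.
  pose K := y |: (z |: (N z :&: D)).
  have KW : K \subset W.
    rewrite !subUset !sub1set yW; move: zD; rewrite inE => /andP[_ ->] /=.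
    by apply/subsetP=> u; rewrite !inE => /and3P[].
  have cK : is_clique e K.
    move=> u v; rewrite ![_ \in K]inE ![_ \in _ |: _]inE ![_ \in [set _]]inE.
    have zu t : t \in N z :&: D -> [/\ e z t, e y t & e x t].
      by case/setIP; rewrite inE => zt /DN[].
    case/or3P=> [/eqP->|/eqP->|uD] /or3P[/eqP->|/eqP->|vD]; rewrite ?eqxx // => uv.
    - by have [] := zu v vD.
    - by rewrite e_sym.
    - by have [] := zu v vD.
    - by rewrite e_sym; have [] := zu u uD.
    - by rewrite e_sym; have [] := zu u uD.
    have [zu1 yu1 xu1] := zu u uD; have [zv1 yv1 xv1] := zu v vD.
    apply/idPn=> nuv.
    by apply: (@common_nbrs_at_most2 u v x y z); rewrite // 1?e_sym //; apply: adj_neq.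
  have := cfW K KW cK; rewrite !cardsU1 !inE.
  by rewrite (negbTE (adj_neq yz)) !e_irr /= andbF /= ltnS; card_lia.
have := @edge_test x y set0 set0 D 7 #|D| 0 0 4 xy (sub0set _) (sub0set _) sub.
have c0 : is_clique e set0 by move=> u v; rewrite inE.
have ap0 B : apart set0 B by move=> u v; rewrite inE.
move=> /(_ c0 c0 (ap0 _) (ap0 _) (ap0 _) dD).
rewrite cards0; (card_facts; nia).
Qed.

(** Here [23 = 20 + 3] comes from [clique_free_deg], and the last term allows each vertex of [W] one
    neighbour on the line. The sets are cut down to exactly [p1] and [t] vertices, so that lower
    bounds on their sizes are enough for a numerical contradiction. *)
Lemma star_line_test x C (W : {set T}) p1 t (xi a1 b : nat) :
    line x C -> W \subset N x :\: C -> clique_free W 10 ->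
    p1 <= #|C| -> t <= #|W| ->
  2 * xi * (a1 * p1 + b * t) <=
    3 * xi * xi + a1 * a1 * p1 * (p1 + 2) + b * b * t * 23 + 2 * b * t * a1.
Proof.
move=> lC WN cfW /card_subset[D DC <-] /card_subset[W' WW' <-].
have [/subsetP CN cC _] := lC.
have W'N : W' \subset N x by apply: subset_trans WW' (subset_trans WN (subsetDl _ _)).
have dW : {in W', forall w, #|N w :&: W'| <= 20}.
  move=> w wW'; apply: (clique_free_deg W'N) => // K /subset_trans/(_ WW').
  exact: cfW.
have c0 : is_clique e set0 by move=> u v; rewrite inE.
have ap0 B : apart B set0 by move=> u v; rewrite !inE.
have cD : is_clique e D by move=> u v /(subsetP DC) ? /(subsetP DC) ?; apply: cC.
have DN : D \subset N x by apply/subsetP=> u /(subsetP DC)/CN.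
have cr : {in W', forall w, w \notin D /\ #|N w :&: D| <= 1}.
  move=> w /(subsetP WW')/(subsetP WN)/setDP[]; rewrite inE => xw wC.
  exact: (line_cross lC).
have cr0 : {in W', forall w, w \notin set0 /\ #|N w :&: set0| <= 1}.
  by move=> w _; rewrite inE setI0 cards0.
have := @star_test x D set0 set0 W' 20 1 xi a1 0 0 b DN (sub0set _) (sub0set _) W'N
   cD c0 c0 (ap0 _) (ap0 _) (ap0 _) dW cr cr0 cr0.
rewrite cards0; card_lia.
Qed.

(** Inequality would be too weak, because [is_line] does not enforce maximality and a part of a line
    can be a line too. *)
Definition distinct_lines (C C' : {set T}) : Prop :=
  ~~ (C \subset C') /\ ~~ (C' \subset C).

Lemma clique_free_sub (W W' : {set T}) m : W' \subset W -> clique_free W m -> clique_free W' m.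
Proof. by move=> sW cf D /subset_trans/(_ sW); apply: cf. Qed.

Lemma sub_clique (C D : {set T}) : D \subset C -> is_clique e C -> is_clique e D.
Proof. by move=> /subsetP sD cC u v /sD uC /sD; apply: cC. Qed.

(** The successors in the size hypotheses pay for the one vertex of each line that is given up to
    clear bridges to the other line. *)
Lemma two_lines_test x C1 C2 (W : {set T}) p1 p2 t (xi a1 a2 b : nat) :
    line x C1 -> line x C2 -> distinct_lines C1 C2 ->
    W \subset N x :\: (C1 :|: C2) -> clique_free W 10 ->
    p1.+1 <= #|C1| -> p2.+1 <= #|C2| -> t <= #|W| ->
  2 * xi * (a1 * p1 + a2 * p2 + b * t) <=
    3 * xi * xi + a1 * a1 * p1 * (p1 + 2) + a2 * a2 * p2 * (p2 + 2)
    + b * b * t * 23 + 2 * b * t * (a1 + a2).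
Proof.
move=> l1 l2 [n12 n21] WN cfW hp1 hp2 /card_subset[W' WW' <-].
have W'N : W' \subset N x by apply: subset_trans WW' (subset_trans WN (subsetDl _ _)).
have dW : {in W', forall w, #|N w :&: W'| <= 20}.
  by move=> w wW'; apply: (clique_free_deg W'N) => //; apply: clique_free_sub cfW.
have [D1 [D1C <- f1]] : exists D : {set T}, [/\ D \subset C1, #|D| = p1 &
    forall C' y z, C' \in [:: C2] -> y \in D -> z \in C' :\: C1 -> ~~ e y z].
  by apply: free_part; rewrite ?addn1 // => C'; rewrite inE => /eqP->; apply: (line_few_bridges l1).
have [D2 [D2C <- f2]] : exists D : {set T}, [/\ D \subset C2, #|D| = p2 &
    forall C' y z, C' \in [:: C1] -> y \in D -> z \in C' :\: C2 -> ~~ e y z].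
  by apply: free_part; rewrite ?addn1 // => C'; rewrite inE => /eqP->; apply: (line_few_bridges l2).
have ap12 : apart D1 D2.
  by apply: (free_parts_apart l1 l2) => // y z; [apply: f1 | apply: f2]; rewrite inE.
have [C1N c1 _] := l1; have [C2N c2 _] := l2.
have c0 : is_clique e set0 by move=> u v; rewrite inE.
have ap0 B : apart B set0 by move=> u v; rewrite !inE.
have cr0 : {in W', forall w, w \notin set0 /\ #|N w :&: set0| <= 1}.
  by move=> w _; rewrite inE setI0 cards0.
have crW w : w \in W' -> [/\ e x w, w \notin C1 & w \notin C2].
  by move=> /(subsetP WW')/(subsetP WN); rewrite !inE negb_or => /andP[/andP[-> ->] ->].
have cr1 : {in W', forall w, w \notin D1 /\ #|N w :&: D1| <= 1}.
  by move=> w /crW[xw w1 w2]; apply: (line_cross l1).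
have cr2 : {in W', forall w, w \notin D2 /\ #|N w :&: D2| <= 1}.
  by move=> w /crW[xw w1 w2]; apply: (line_cross l2).
have := @star_test x D1 D2 set0 W' 20 1 xi a1 a2 0 b (subset_trans D1C C1N)
   (subset_trans D2C C2N) (sub0set _) W'N (sub_clique D1C c1) (sub_clique D2C c2) c0
   ap12 (ap0 _) (ap0 _) dW cr1 cr2 cr0.
rewrite cards0; card_lia.
Qed.

Lemma three_free_parts x C1 C2 C3 (Es : seq {set T}) p1 p2 p3 :
    line x C1 -> line x C2 -> line x C3 ->
    distinct_lines C1 C2 -> distinct_lines C1 C3 -> distinct_lines C2 C3 ->
    (forall E C, E \in Es -> line x C -> few_bridges C E) ->
    p1.+2 + size Es <= #|C1| -> p2.+2 + size Es <= #|C2| -> p3.+2 + size Es <= #|C3| ->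
  exists D1 D2 D3 : {set T},
    [/\ [/\ D1 \subset C1, D2 \subset C2 & D3 \subset C3],
        [/\ #|D1| = p1, #|D2| = p2 & #|D3| = p3],
        [/\ apart D1 D2, apart D1 D3 & apart D2 D3]
      & forall E z, E \in Es -> z \in E ->
          [/\ z \notin C1 -> {in D1, forall y, ~~ e y z},
              z \notin C2 -> {in D2, forall y, ~~ e y z}
            & z \notin C3 -> {in D3, forall y, ~~ e y z}]].
Proof.
move=> l1 l2 l3 [n12 n21] [n13 n31] [n23 n32] fE h1 h2 h3.
have part C C' C'' p : line x C -> line x C' -> line x C'' -> p.+2 + size Es <= #|C| ->
    exists D : {set T}, [/\ D \subset C, #|D| = p &
    forall B y z, B \in [:: C', C'' & Es] -> y \in D -> z \in B :\: C -> ~~ e y z].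
  move=> lC lC' lC'' hC; apply: free_part; last by rewrite /= !addnS.
  move=> B; rewrite !inE => /or3P[/eqP->|/eqP->|BE]; last exact: fE.
    exact: (line_few_bridges lC lC').
  exact: (line_few_bridges lC lC'').
have [D1 [s1 c1 f1]] := part C1 C2 C3 p1 l1 l2 l3 h1.
have [D2 [s2 c2 f2]] := part C2 C1 C3 p2 l2 l1 l3 h2.
have [D3 [s3 c3 f3]] := part C3 C1 C2 p3 l3 l1 l2 h3.
exists D1, D2, D3; split=> //.
  split.
  - by apply: (free_parts_apart l1 l2) => // y z; [apply: f1 | apply: f2]; rewrite !inE eqxx.
  - by apply: (free_parts_apart l1 l3) => // y z; [apply: f1 | apply: f3]; rewrite !inE eqxx ?orbT.
  - by apply: (free_parts_apart l2 l3) => // y z; [apply: f2 | apply: f3]; rewrite !inE eqxx ?orbT.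
move=> E z EE zE; split=> zC y yD.
- by apply: (f1 E); rewrite ?inE ?EE ?orbT // zC.
- by apply: (f2 E); rewrite ?inE ?EE ?orbT // zC.
- by apply: (f3 E); rewrite ?inE ?EE ?orbT // zC.
Qed.

Lemma three_lines_test x C1 C2 C3 (W : {set T}) p1 p2 p3 t (xi a1 a2 a3 b : nat) :
    line x C1 -> line x C2 -> line x C3 ->
    distinct_lines C1 C2 -> distinct_lines C1 C3 -> distinct_lines C2 C3 ->
    W \subset N x :\: (C1 :|: C2 :|: C3) -> clique_free W 10 ->
    p1.+2 <= #|C1| -> p2.+2 <= #|C2| -> p3.+2 <= #|C3| -> t <= #|W| ->
  2 * xi * (a1 * p1 + a2 * p2 + a3 * p3 + b * t) <=
    3 * xi * xi + a1 * a1 * p1 * (p1 + 2) + a2 * a2 * p2 * (p2 + 2)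
    + a3 * a3 * p3 * (p3 + 2) + b * b * t * 23 + 2 * b * t * (a1 + a2 + a3).
Proof.
move=> l1 l2 l3 n12 n13 n23 WN cfW hp1 hp2 hp3 /card_subset[W' WW' <-].
have W'N : W' \subset N x by apply: subset_trans WW' (subset_trans WN (subsetDl _ _)).
have dW : {in W', forall w, #|N w :&: W'| <= 20}.
  by move=> w wW'; apply: (clique_free_deg W'N) => //; apply: clique_free_sub cfW.
have [||||D1 [D2 [D3 [[s1 s2 s3] [<- <- <-] [ap12 ap13 ap23] _]]]] :=
  @three_free_parts x C1 C2 C3 [::] p1 p2 p3 l1 l2 l3 n12 n13 n23; rewrite ?addn0 //.
have [C1N c1 _] := l1; have [C2N c2 _] := l2; have [C3N c3 _] := l3.
have crW w : w \in W' -> [/\ e x w, w \notin C1, w \notin C2 & w \notin C3].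
  move=> /(subsetP WW')/(subsetP WN); rewrite !inE !negb_or.
  by case/andP=> /andP[/andP[-> ->] ->] ->.
have := @star_test x D1 D2 D3 W' 20 1 xi a1 a2 a3 b (subset_trans s1 C1N)
   (subset_trans s2 C2N) (subset_trans s3 C3N) W'N (sub_clique s1 c1) (sub_clique s2 c2)
   (sub_clique s3 c3) ap12 ap13 ap23 dW.
have cr1 : {in W', forall w, w \notin D1 /\ #|N w :&: D1| <= 1}.
  by move=> w /crW[xw ? ? ?]; apply: (line_cross l1).
have cr2 : {in W', forall w, w \notin D2 /\ #|N w :&: D2| <= 1}.
  by move=> w /crW[xw ? ? ?]; apply: (line_cross l2).
have cr3 : {in W', forall w, w \notin D3 /\ #|N w :&: D3| <= 1}.
  by move=> w /crW[xw ? ? ?]; apply: (line_cross l3).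
move=> /(_ cr1 cr2 cr3); card_lia.
Qed.

(** When the rest is a single vertex, it pays to clear the lines of neighbours of [w] as well: a
    third vertex is lost on each line, but all cross terms with [w] vanish. *)
Lemma three_lines_vertex_test x C1 C2 C3 w p1 p2 p3 (xi a1 a2 a3 b : nat) :
    line x C1 -> line x C2 -> line x C3 ->
    distinct_lines C1 C2 -> distinct_lines C1 C3 -> distinct_lines C2 C3 ->
    w \in N x :\: (C1 :|: C2 :|: C3) ->
    p1.+3 <= #|C1| -> p2.+3 <= #|C2| -> p3.+3 <= #|C3| ->
  2 * xi * (a1 * p1 + a2 * p2 + a3 * p3 + b) <=
    3 * xi * xi + a1 * a1 * p1 * (p1 + 2) + a2 * a2 * p2 * (p2 + 2)
    + a3 * a3 * p3 * (p3 + 2) + b * b * 3.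
Proof.
move=> l1 l2 l3 n12 n13 n23 wN hp1 hp2 hp3.
have [xw w1 w2 w3] : [/\ e x w, w \notin C1, w \notin C2 & w \notin C3].
  by move: wN; rewrite !inE !negb_or => /andP[/andP[/andP[-> ->] ->] ->].
have fw E C : E \in [:: [set w]] -> line x C -> few_bridges C E.
  by rewrite inE => /eqP-> lC; apply: (vertex_few_bridges lC).
have [|||D1 [D2 [D3 [[s1 s2 s3] [<- <- <-] [ap12 ap13 ap23] fr]]]] :=
  @three_free_parts x C1 C2 C3 [:: [set w]] p1 p2 p3 l1 l2 l3 n12 n13 n23 fw; rewrite ?addn1 //.
have [/(_ w1) fr1 /(_ w2) fr2 /(_ w3) fr3] := fr [set w] w (mem_head _ _) (set11 _).
have [C1N c1 _] := l1; have [C2N c2 _] := l2; have [C3N c3 _] := l3.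
have wsub : [set w] \subset N x by rewrite sub1set inE.
have dW : {in [set w], forall v, #|N v :&: [set w]| <= 0}.
  move=> v; rewrite inE => /eqP->; rewrite leqn0 cards_eq0; apply/eqP/setP=> u.
  by rewrite !inE; case: eqVneq => [->|]; rewrite ?e_irr ?andbF.
have cr (C D : {set T}) : w \notin C -> D \subset C -> {in D, forall y, ~~ e y w} ->
    {in [set w], forall v, v \notin D /\ #|N v :&: D| <= 0}.
  move=> wC /subsetP DC frD v; rewrite inE => /eqP->.
  split; first by apply: contraNN wC => /DC.
  rewrite leqn0 cards_eq0; apply/eqP/setP=> u; rewrite !inE.
  by apply/negP=> /andP[wu /frD]; rewrite e_sym wu.
have := @star_test x D1 D2 D3 [set w] 0 0 xi a1 a2 a3 b (subset_trans s1 C1N)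
   (subset_trans s2 C2N) (subset_trans s3 C3N) wsub (sub_clique s1 c1) (sub_clique s2 c2)
   (sub_clique s3 c3) ap12 ap13 ap23 dW (cr C1 D1 w1 s1 fr1)
   (cr C2 D2 w2 s2 fr2) (cr C3 D3 w3 s3 fr3).
rewrite cards1; card_lia.
Qed.

(** Each line loses one vertex to each of the three others, which leaves four apart cliques of size
    7. The form tolerates such a star only if the sum of [p / (p + 2)] over the clique sizes is at
    most 3, and [4 * 7 / 9] exceeds 3. Cliques of size 6 would give exactly 3, which is why long
    means at least 10. *)
Lemma no_four_long_lines x C1 C2 C3 C4 :
    line x C1 -> line x C2 -> line x C3 -> line x C4 ->
    distinct_lines C1 C2 -> distinct_lines C1 C3 -> distinct_lines C2 C3 ->
    distinct_lines C1 C4 -> distinct_lines C2 C4 -> distinct_lines C3 C4 ->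
    10 <= #|C1| -> 10 <= #|C2| -> 10 <= #|C3| -> 10 <= #|C4| -> False.
Proof.
move=> l1 l2 l3 l4 n12 n13 n23 n14 n24 n34 h1 h2 h3 h4.
have f4 E C : E \in [:: C4] -> line x C -> few_bridges C E.
  by rewrite inE => /eqP-> lC; apply: (line_few_bridges lC l4).
have [|||D1 [D2 [D3 [[s1 s2 s3] [p1 p2 p3] [ap12 ap13 ap23] fr]]]] :=
  @three_free_parts x C1 C2 C3 [:: C4] 7 7 7 l1 l2 l3 n12 n13 n23 f4; rewrite ?addn1 //.
have [D4 [s4 p4 fr4]] : exists D : {set T}, [/\ D \subset C4, #|D| = 7 &
    forall C' y z, C' \in [:: C1; C2; C3] -> y \in D -> z \in C' :\: C4 -> ~~ e y z].
  apply: free_part => // C'; rewrite !inE => /or3P[] /eqP->; apply: (@line_few_bridges x) => //.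
have ap C (D : {set T}) : line x C -> C \in [:: C1; C2; C3] -> distinct_lines C C4 -> D \subset C ->
    (forall z, z \in C4 -> z \notin C -> {in D, forall y, ~~ e y z}) -> apart D D4.
  move=> lC Cin [nC nC4] DC frD; apply: (free_parts_apart lC l4) => // y z yD.
    by case/setDP=> zC4 zC; apply: frD.
  exact: fr4.
have ap1 : apart D1 D4.
  apply: (ap C1) => //; first by rewrite !inE eqxx.
  by move=> z z4 z1; have [/(_ z1)] := fr C4 z (mem_head _ _) z4.
have ap2 : apart D2 D4.
  apply: (ap C2) => //; first by rewrite !inE eqxx ?orbT.
  by move=> z z4 z2; have [_ /(_ z2)] := fr C4 z (mem_head _ _) z4.
have ap3 : apart D3 D4.
  apply: (ap C3) => //; first by rewrite !inE eqxx ?orbT.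
  by move=> z z4 z3; have [_ _ /(_ z3)] := fr C4 z (mem_head _ _) z4.
have [C1N c1 _] := l1; have [C2N c2 _] := l2; have [C3N c3 _] := l3; have [C4N c4 _] := l4.
have dW : {in D4, forall v, #|N v :&: D4| <= 6}.
  move=> v vD; have := cardsD1 v D4; rewrite vD p4 => -[->].
  apply: subset_leq_card; apply/subsetP=> u; rewrite !inE => /andP[vu ->].
  by rewrite eq_sym adj_neq.
have cr D : apart D D4 -> {in D4, forall v, v \notin D /\ #|N v :&: D| <= 0}.
  move=> apD v vD4; split.
    by apply/negP=> vD; have [] := apD v v vD vD4; rewrite eqxx.
  rewrite leqn0 cards_eq0; apply/eqP/setP=> u; rewrite !inE.
  by apply/negP=> /andP[vu uD]; have [_] := apD u v uD vD4; rewrite e_sym vu.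
have := @star_test x D1 D2 D3 D4 6 0 9 1 1 1 1 (subset_trans s1 C1N)
   (subset_trans s2 C2N) (subset_trans s3 C3N) (subset_trans s4 C4N)
   (sub_clique s1 c1) (sub_clique s2 c2)
   (sub_clique s3 c3) ap12 ap13 ap23 dW (cr _ ap1) (cr _ ap2) (cr _ ap3).
by rewrite p1 p2 p3 p4.
Qed.

(** One round of a greedy extraction of long lines. The new line extends a large clique inside [W];
    if it contained an old line [C0], a vertex of that clique would be adjacent to all of [C0],
    which has at least two vertices. *)
Lemma long_line_outside x (W : {set T}) : W \subset N x ->
  clique_free W 10 \/
  exists C, [/\ line x C, 10 <= #|C| & forall C0, line x C0 -> 2 <= #|C0| ->
    [disjoint W & C0] -> distinct_lines C0 C].
Proof.
move=> WN.
case: (boolP [exists D : {set T}, [&& D \subset W, 10 <= #|D| & cliqueb e D]])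
    => [/existsP[D /and3P[DW D10 /cliqueP cliqueD]]|nbad]; [right | left].
  have [C lC DC] := clique_sub_line (subset_trans DW WN) cliqueD.
  exists C; split=> //; first exact: leq_trans D10 (subset_leq_card DC).
  move=> C0 l0 C02 dis.
  have /set0Pn[v vD] : D != set0 by rewrite -card_gt0; apply: leq_trans D10.
  have vC := subsetP DC v vD; have vW := subsetP DW v vD.
  have vC0 : v \notin C0 by move/disjoint_setI0/setP/(_ v): dis; rewrite !inE vW => /negbT.
  have [_ _ l03] := l0; split; last by apply/subsetPn; exists v.
  apply/negP=> /subsetP C0C; move: C02; rewrite ltnNge => /negP; apply.
  apply/card_le1_eqP=> p q pC0 qC0.
  have vneq t : t \in C0 -> v != t by move=> tC0; apply: contraNneq vC0 => ->.
  apply: (l03 v) => //; first exact: (line_adj lC vC).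
    by apply: (line_clique lC); rewrite ?vneq // C0C.
  by apply: (line_clique lC); rewrite ?vneq // C0C.
move=> D DW cD; rewrite ltnNge; apply: contraNN nbad => D10.
by apply/existsP; exists D; rewrite DW D10; apply/cliqueP.
Qed.

Lemma card_nbhd_two x (C1 C2 : {set T}) : k <= #|C1| + #|C2| + #|N x :\: (C1 :|: C2)|.
Proof.
rewrite -(reg x) -(cardsID (C1 :|: C2) (N x)) leq_add2r.
exact: leq_trans (subset_leq_card (subsetIr _ _)) (leq_card_setU _ _).
Qed.

Lemma card_nbhd_three x (C1 C2 C3 : {set T}) :
  k <= #|C1| + #|C2| + #|C3| + #|N x :\: (C1 :|: C2 :|: C3)|.
Proof.
apply: leq_trans (card_nbhd_two x (C1 :|: C2) C3) _.
by rewrite leq_add2r leq_add2r leq_card_setU.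
Qed.

(** * Covering a neighbourhood by long lines when no line exceeds half of it *)

Section Cover.
Hypothesis k_ge120 : 120 <= k.
Variable x : T.
Hypothesis not_huge : forall C, line x C -> 2 * #|C| <= k.+1.

(** A bootstrap: an upper bound on the rest, together with [not_huge], bounds both lines from below,
    and longer lines make the test sharper. Three rounds bound the rest by 45, 32 and 28. *)
Lemma two_lines_small_rest C1 C2 : line x C1 -> line x C2 -> distinct_lines C1 C2 ->
  10 <= #|C1| -> 10 <= #|C2| -> clique_free (N x :\: (C1 :|: C2)) 10 ->
  [/\ #|N x :\: (C1 :|: C2)| <= 28, 32 <= #|C1| & 32 <= #|C2|].
Proof.
wlog le21 : C1 C2 / #|C2| <= #|C1| => [IH l1 l2 [n12 n21] h1 h2 cf|].
  have [le21|/ltnW le12] := leqP #|C2| #|C1|; first exact: IH.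
  by rewrite setUC in cf *; have [] := IH C2 C1 le12 l2 l1 (conj n21 n12) h2 h1 cf.
move=> l1 l2 n12 h1 h2 cf.
have tot := card_nbhd_two x C1 C2; have hu := not_huge l1.
have W1 : #|N x :\: (C1 :|: C2)| <= 45.
  rewrite leqNgt; apply/negP=> tW.
  by have := @two_lines_test x C1 C2 _ 9 9 46 27 2 2 1 l1 l2 n12 (subxx _) cf h1 h2 tW.
have W2 : #|N x :\: (C1 :|: C2)| <= 32.
  rewrite leqNgt; apply/negP=> tW.
  have p1 : 38 <= #|C1| by card_lia.
  have p2 : 15 <= #|C2| by card_lia.
  by have := @two_lines_test x C1 C2 _ 37 14 33 76 2 4 3 l1 l2 n12 (subxx _) cf p1 p2 tW; card_lia.
have W3 : #|N x :\: (C1 :|: C2)| <= 28.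
  rewrite leqNgt; apply/negP=> tW.
  have p1 : 44 <= #|C1| by card_lia.
  have p2 : 28 <= #|C2| by card_lia.
  by have := @two_lines_test x C1 C2 _ 43 27 29 94 2 3 4 l1 l2 n12 (subxx _) cf p1 p2 tW; card_lia.
by split; card_lia.
Qed.

(** The same bootstrap bounds the rest by 27 and 13; then a single remaining vertex is already
    impossible. *)
Lemma three_sorted_lines_cover C1 C2 C3 : line x C1 -> line x C2 -> line x C3 ->
  distinct_lines C1 C2 -> distinct_lines C1 C3 -> distinct_lines C2 C3 ->
  #|C2| <= #|C1| -> #|C3| <= #|C2| -> 10 <= #|C3| ->
  clique_free (N x :\: (C1 :|: C2 :|: C3)) 10 -> N x :\: (C1 :|: C2 :|: C3) = set0.
Proof.
move=> l1 l2 l3 n12 n13 n23 le21 le32 h3 cf.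
have tot := card_nbhd_three x C1 C2 C3; have hu := not_huge l1.
have h2 := leq_trans h3 le32; have h1 := leq_trans h2 le21.
have W1 : #|N x :\: (C1 :|: C2 :|: C3)| <= 27.
  rewrite leqNgt; apply/negP=> tW.
  by have := @three_lines_test x C1 C2 C3 _ 8 8 8 28 33 3 3 3 1 l1 l2 l3 n12 n13 n23
    (subxx _) cf h1 h2 h3 tW; card_lia.
have W2 : #|N x :\: (C1 :|: C2 :|: C3)| <= 13.
  rewrite leqNgt; apply/negP=> tW.
  have p1 : 31 <= #|C1| by card_lia.
  have p2 : 17 <= #|C2| by card_lia.
  by have := @three_lines_test x C1 C2 C3 _ 29 15 8 14 32 1 2 3 1 l1 l2 l3 n12 n13 n23
    (subxx _) cf p1 p2 h3 tW; card_lia.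
apply/eqP/set0Pn=> -[w wW].
(* If the shortest line is small, the other two must be longer, and other weights are needed. *)
have [p3|p3] := leqP 14 #|C3|.
  have p1 : 36 <= #|C1| by card_lia.
  have p2 : 24 <= #|C2| by card_lia.
  by have := @three_lines_vertex_test x C1 C2 C3 w 33 21 11 66 2 3 5 16 l1 l2 l3 n12 n13 n23
    wW p1 p2 p3; card_lia.
have p1 : 47 <= #|C1| by card_lia.
have p2 : 34 <= #|C2| by card_lia.
by have := @three_lines_vertex_test x C1 C2 C3 w 44 31 7 93 2 3 10 29 l1 l2 l3 n12 n13 n23
    wW p1 p2 h3; card_lia.
Qed.

Lemma distinct_linesC C C' : distinct_lines C C' -> distinct_lines C' C.
Proof. by case. Qed.

Lemma three_lines_cover C1 C2 C3 : line x C1 -> line x C2 -> line x C3 ->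
  distinct_lines C1 C2 -> distinct_lines C1 C3 -> distinct_lines C2 C3 ->
  10 <= #|C1| -> 10 <= #|C2| -> 10 <= #|C3| ->
  clique_free (N x :\: (C1 :|: C2 :|: C3)) 10 -> N x :\: (C1 :|: C2 :|: C3) = set0.
Proof.
move=> l1 l2 l3 n12 n13 n23 h1 h2 h3 cf.
have sw (A B C : {set T}) : A :|: B :|: C = B :|: A :|: C by rewrite (setUC A).
have sw' (A B C : {set T}) : A :|: B :|: C = A :|: C :|: B by rewrite setUAC.
have n21 := distinct_linesC n12; have n31 := distinct_linesC n13; have n32 := distinct_linesC n23.
have [a12|a12] := leqP #|C1| #|C2|; have [a13|a13] := leqP #|C1| #|C3|;
  have [a23|a23] := leqP #|C2| #|C3|.
- have E : C1 :|: C2 :|: C3 = C3 :|: C2 :|: C1 by rewrite sw sw' sw.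
  by rewrite E in cf *; apply: three_sorted_lines_cover.
- have E : C1 :|: C2 :|: C3 = C2 :|: C3 :|: C1 by rewrite sw sw'.
  by rewrite E in cf *; apply: three_sorted_lines_cover => //; apply: ltnW.
- by have := leq_trans a12 a23; rewrite leqNgt a13.
- have E : C1 :|: C2 :|: C3 = C2 :|: C1 :|: C3 by rewrite sw.
  by rewrite E in cf *; apply: three_sorted_lines_cover => //; apply: ltnW.
- have E : C1 :|: C2 :|: C3 = C3 :|: C1 :|: C2 by rewrite sw' sw.
  by rewrite E in cf *; apply: three_sorted_lines_cover => //; apply: ltnW.
- by have := ltn_trans a12 (leq_ltn_trans a13 a23); rewrite ltnn.
- have E : C1 :|: C2 :|: C3 = C1 :|: C3 :|: C2 by rewrite sw'.
  by rewrite E in cf *; apply: three_sorted_lines_cover => //; apply: ltnW.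
by apply: three_sorted_lines_cover => //; apply: ltnW.
Qed.

Lemma nbhd_cover :
  (exists C1 C2, [/\ line x C1, line x C2, distinct_lines C1 C2,
     32 <= #|C1| /\ 32 <= #|C2| & #|N x :\: (C1 :|: C2)| <= 28 /\
     {in N x :\: (C1 :|: C2), forall w, #|N w :&: (N x :\: (C1 :|: C2))| <= 20}]) \/
  (exists C1 C2 C3, [/\ [/\ line x C1, line x C2 & line x C3],
     [/\ distinct_lines C1 C2, distinct_lines C1 C3 & distinct_lines C2 C3],
     [/\ 10 <= #|C1|, 10 <= #|C2| & 10 <= #|C3|] & N x = C1 :|: C2 :|: C3]).
Proof.
have [cf|[C1 [l1 h1 _]]] := long_line_outside (subxx (N x)).
  (* The line only fills an argument of the test: with [p1 = 0] it carries no weight. The 70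
     vertices outside it suffice, because without 10-cliques the degrees there are at most 20. *)
  have [C lC _] := @clique_sub_line x set0 (sub0set _) (fun u v h => ltac:(by rewrite inE in h)).
  have [CN cC _] := lC; have := cf C CN cC => C10.
  have cW : 70 <= #|N x :\: C| by rewrite cardsD reg (setIidPr CN); card_lia.
  have := @star_line_test x C _ 0 70 70 0 3 lC (subxx _) (clique_free_sub (subsetDl _ _) cf) isT cW.
  by card_lia.
have [cf|[C2 [l2 h2 d2]]] := long_line_outside (subsetDl (N x) C1).
  have [CN cC _] := l1; have hu := not_huge l1.
  have cW : 60 <= #|N x :\: C1| by rewrite cardsD reg (setIidPr CN); card_lia.
  have := @star_line_test x C1 _ 10 60 46 2 2 l1 (subxx _) cf h1 cW.
  by card_lia.
have dis (A B : {set T}) : B \subset A -> [disjoint N x :\: A & B].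
  move=> /subsetP BA; rewrite -setI_eq0; apply/eqP/setP=> z; rewrite !inE.
  by case zB: (z \in B); rewrite ?andbF // (BA z zB).
have n12 : distinct_lines C1 C2 by apply: d2; rewrite ?dis //; apply: leq_trans h1.
have [cf|[C3 [l3 h3 d3]]] := long_line_outside (subsetDl (N x) (C1 :|: C2)).
  left; exists C1, C2; have [W28 h1' h2'] := two_lines_small_rest l1 l2 n12 h1 h2 cf.
  by split=> //; split=> // w wW; apply: (clique_free_deg (x := x)); rewrite // subsetDl.
have n13 : distinct_lines C1 C3.
  by apply: d3; rewrite ?dis ?subsetUl //; apply: leq_trans h1.
have n23 : distinct_lines C2 C3.
  by apply: d3; rewrite ?dis ?subsetUr //; apply: leq_trans h2.
have [cf|[C4 [l4 h4 d4]]] := long_line_outside (subsetDl (N x) (C1 :|: C2 :|: C3)).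
  right; exists C1, C2, C3; split=> //.
  have W0 := three_lines_cover l1 l2 l3 n12 n13 n23 h1 h2 h3 cf.
  apply/eqP; rewrite eqEsubset -setD_eq0 W0 eqxx !subUset.
  by case: l1 => -> _ _; case: l2 => -> _ _; case: l3 => -> _ _.
exfalso; apply: (@no_four_long_lines x C1 C2 C3 C4) => //; apply: d4 => //;
  rewrite ?dis ?subsetUr // ?(leq_trans _ h1) ?(leq_trans _ h2) ?(leq_trans _ h3) //.
- by rewrite -setUA subsetUl.
- by rewrite (setUC C1) -setUA subsetUl.
Qed.
End Cover.

(** Made to contradict itself at a neighbour: the second part at [x] says that [c] sees the induced
    path [b], [x], [c'] and that [a c c'] is small, while the first part at [c] would make [a c c']
    large. *)
Definition locally_linked x : Prop :=
  (forall y, e x y -> k <= 2 * (a x y).+1) /\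
  exists c c' b, [/\ e x c, e c c' /\ e x c', e c b /\ e x b, b != c' /\ ~~ e b c'
    & 2 * (a c c').+2 <= k].

(** A vertex of [C'] outside [C] is adjacent to every common vertex, and so to at most one. *)
Lemma lines_meet x C C' u v : line x C -> line x C' -> ~~ (C' \subset C) ->
  u \in C -> u \in C' -> v \in C -> v \in C' -> u = v.
Proof.
move=> [_ _ l3] lC' /subsetPn[w wC' wC] uC uC' vC vC'.
have neq t : t \in C -> w != t by move=> tC; apply: contraNneq wC => ->.
apply: (l3 w) => //; first exact: (line_adj lC').
  by apply: (line_clique lC'); rewrite ?neq.
by apply: (line_clique lC'); rewrite ?neq.
Qed.

(** Since [c'] lies on both other lines, the edge from [c] to [c'] is a bridge from [Cj] to each of
    them. By uniqueness every other vertex of [Cj] has no bridge at all. *)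
Lemma path_leaf_free x Ci Cj Cd c c' b z :
    line x Ci -> line x Cj -> line x Cd -> N x = Ci :|: Cj :|: Cd ->
    c \in Cj -> c' \in Ci -> c' \in Cd -> e c c' -> c' \notin Cj ->
    b \in Cj -> b != c -> e x z -> e b z -> z \in Cj.
Proof.
move=> li lj ld NE cj c'i c'd cc' c'j bj bc xz bz; apply/idPn=> zj.
have : z \in N x by rewrite inE.
rewrite NE !inE (negbTE zj) orbF => /orP[zi|zd]; case/negP: bc; apply/eqP.
  by apply: (@line_bridge_uniq x Cj Ci b c z c'); rewrite // inE ?zj ?c'j.
by apply: (@line_bridge_uniq x Cj Cd b c z c'); rewrite // inE ?zj ?c'j.
Qed.

(* The line [Ci] meets [Cj] in [c] and [Cd] in [c'].  By [near_pair] the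
   further vertices of [Ci] would have disjoint sets of common neighbours with [c]
   outside both lines, too large for the degree of [c]. *)
Section PathOfLines.
Variables (x : T) (Ci Cj Cd : {set T}) (c c' : T).
Hypotheses (li : line x Ci) (lj : line x Cj) (ld : line x Cd).
Hypotheses (nij : distinct_lines Ci Cj) (nid : distinct_lines Ci Cd).
Hypothesis NE : N x = Ci :|: Cj :|: Cd.
Hypotheses (ci : c \in Ci) (cj : c \in Cj) (c'i : c' \in Ci) (c'd : c' \in Cd).
Hypothesis cc'_neq : c != c'.
Hypothesis jd : [disjoint Cj & Cd].
Hypotheses (hj : 7 <= #|Cj|) (hd : 7 <= #|Cd|).

Lemma path_of_lines : [/\ #|Ci| = 2, l.+2 = k & locally_linked x].
Proof.
have jd0 z : z \in Cj -> z \in Cd -> False.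
  by move=> zj zd; move/disjoint_setI0/setP/(_ z): jd; rewrite !inE zj zd.
have [nij1 nij2] := nij; have [nid1 nid2] := nid.
have cc' : e c c' by apply: (line_clique li).
have xc := line_adj li ci; have xc' := line_adj li c'i.
have c'j : c' \notin Cj by apply/negP=> c'j; apply: (jd0 c').
have cd : c \notin Cd by apply/negP=> h; apply: (jd0 c).
have freej b z : b \in Cj -> b != c -> e x z -> e b z -> z \in Cj.
  exact: (path_leaf_free li lj ld NE cj c'i c'd cc' c'j).
have freed d z : d \in Cd -> d != c' -> e x z -> e d z -> z \in Cd.
  apply: (path_leaf_free li ld lj _ c'd ci cj) => //; last by rewrite e_sym.
  by rewrite NE setUAC.
have freei y z : y \in Ci -> y != c -> y != c' -> e x z -> e y z -> z \in Ci.
  move=> yi yc yc' xz yz; apply/idPn=> zi.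
  have : z \in N x by rewrite inE.
  rewrite NE !inE (negbTE zi) /= => /orP[zj|zd].
    have [v vj vi] := subsetPn nij2; case/negP: yc; apply/eqP.
    apply: (@line_bridge_uniq x Ci Cj y c z v); rewrite // ?inE ?zi ?vi //.
    by apply: (line_clique lj) => //; apply: contraNneq vi => <-.
  have [v vd vi] := subsetPn nid2; case/negP: yc'; apply/eqP.
  apply: (@line_bridge_uniq x Ci Cd y c' z v); rewrite // ?inE ?zi ?vi //.
  by apply: (line_clique ld) => //; apply: contraNneq vi => <-.
have /set0Pn[b /setD1P[bc bj]] : Cj :\ c != set0.
  by rewrite -card_gt0; have := cardsD1 c Cj; rewrite cj; card_lia.
have /set0Pn[d /setD1P[dc' dd]] : Cd :\ c' != set0.
  by rewrite -card_gt0; have := cardsD1 c' Cd; rewrite c'd; card_lia.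
have xb := line_adj lj bj; have xd := line_adj ld dd.
have ab : (a x b).+1 = #|Cj| by apply: (line_deg_eq lj) => // z; apply: freej.
have ad : (a x d).+1 = #|Cd| by apply: (line_deg_eq ld) => // z; apply: freed.
have bd : ~~ e b d by apply/negP=> bd; apply: (jd0 d) => //; apply: freej bd.
have L1 : a x b + a x d = l.
  apply: far_pair => //; first by apply/eqP=> E; apply: (jd0 b) => //; rewrite E.
  move=> v xv bv dv; apply: (jd0 v); first exact: freej bv.
  exact: freed dv.
have bc' : b != c' by apply: contraNneq c'j => <-.
have nbc' : ~~ e b c' by apply/negP=> h; case/negP: c'j; apply: freej h.
have ebc : e b c by apply: (line_clique lj).
have edc' : e d c' by apply: (line_clique ld).
(* With [L1], the identities [L2] and [L3] and the bounds [B2] and [B3] force [#|Cj| = #|Cd|]. *)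
have L2 : a x b + a c b = l by apply: (@near_pair x b c' c); rewrite // e_sym.
have ndc : ~~ e d c by apply/negP=> h; case/negP: cd; apply: freed h.
have dc : d != c by apply: contraNneq cd => <-.
have L3 : a x d + a c' d = l by apply: (@near_pair x d c c').
have B2 : #|Cj| <= (a c b).+1 by apply: (line_pair_deg_ge lj); rewrite // eq_sym.
have B3 : #|Cd| <= (a c' d).+1 by apply: (line_pair_deg_ge ld); rewrite // eq_sym.
(* Together with [B4], [B5] and the value of [l] this gives [2 * #|Ci| <= #|Cj| + 1]. *)
have L4 : a x c' + a c c' = l.
  by apply: (@near_pair x c' b c) => //; rewrite 1?eq_sym // e_sym.
have B4 : #|Ci| <= (a c c').+1 by apply: (line_pair_deg_ge li).
have icd t : t \in Ci -> t \in Cd -> t = c' by move=> *; apply: (lines_meet li ld).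
have icj t : t \in Ci -> t \in Cj -> t = c by move=> *; apply: (lines_meet li lj).
have cardid : #|Ci :|: Cd| + 1 = #|Ci| + #|Cd|.
  rewrite -cardsUI (_ : Ci :&: Cd = [set c']) ?cards1 //.
  by apply/setP=> t; rewrite !inE; apply/andP/eqP=> [[]|->]; [apply: icd | split].
have cardij : #|Ci :|: Cj| + 1 = #|Ci| + #|Cj|.
  rewrite -cardsUI (_ : Ci :&: Cj = [set c]) ?cards1 //.
  by apply/setP=> t; rewrite !inE; apply/andP/eqP=> [[]|->]; [apply: icj | split].
have B5 : #|Ci| + #|Cd| <= a x c' + 2.
  have sub : (Ci :|: Cd) :\ c' \subset common_nbrs e x c'.
    apply/subsetP=> z /setD1P[zc' /setUP[zi|zd]]; rewrite in_common.
      by rewrite (line_adj li zi) (line_clique li) // eq_sym.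
    by rewrite (line_adj ld zd) (line_clique ld) // eq_sym.
  have := subset_leq_card sub; have := cardsD1 c' (Ci :|: Cd).
  by rewrite inE c'i /=; card_lia.
have Ek : k + 2 = #|Ci| + #|Cj| + #|Cd|.
  rewrite -(reg x) NE setUAC; have := cardsUI (Ci :|: Cd) Cj.
  rewrite (_ : (Ci :|: Cd) :&: Cj = [set c]) ?cards1; first by card_lia.
  apply/setP=> t; rewrite !inE; apply/andP/eqP=> [[/orP[ti|td] tj]|->].
  - exact: icj.
  - by case: (jd0 t).
  - by rewrite ci.
have rest y : y \in Ci -> y != c -> y != c' ->
    2 * #|Cj| <= #|common_nbrs e c y :\: (x |: Ci)| + 2 * #|Ci| /\
    common_nbrs e c y :\: (x |: Ci) \subset N c :\: (x |: (Ci :|: Cj)).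
  move=> yi yc yc'; have ay : (a x y).+1 = #|Ci|.
    by apply: (line_deg_eq li) => // z; apply: freei.
  have nyb : ~~ e y b.
    apply/negP=> yb; case/negP: bc; apply/eqP; apply: icj => //.
    exact: freei yb.
  have yb : y != b by apply/eqP=> E; case/negP: yc; apply/eqP; apply: icj; rewrite // E.
  have L5 : a x y + a c y = l.
    apply: (@near_pair x y b c) => //; first exact: (line_adj li).
    exact: (line_clique li).
  split; last first.
    apply/subsetP=> r; rewrite !inE => /andP[nr /andP[cr yr]]; rewrite cr andbT.
    rewrite orbA negb_or nr /=; apply/negP=> rj; move: nr; rewrite negb_or => /andP[_ /negP]; apply.
    by apply: freei yr => //; apply: (line_adj lj).
  have := cardsID (x |: Ci) (common_nbrs e c y).
  have : #|common_nbrs e c y :&: (x |: Ci)| <= #|x |: (Ci :\ c :\ y)|.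
    apply: subset_leq_card; apply/subsetP=> z; rewrite !inE => /andP[/andP[cz yz] /orP[->//|zi]].
    by rewrite zi ![z == _]eq_sym (adj_neq cz) (adj_neq yz) orbT.
  rewrite cardsU1; case: (x \notin Ci :\ c :\ y); have := cardsD1 c Ci;
    have := cardsD1 y (Ci :\ c); rewrite ci !inE yi yc /=; card_lia.
have restN : #|N c :\: (x |: (Ci :|: Cj))| + #|Ci| + #|Cj| <= k.+1.
  have := cardsID (x |: (Ci :|: Cj)) (N c); rewrite reg.
  have : #|x |: ((Ci :|: Cj) :\ c)| <= #|N c :&: (x |: (Ci :|: Cj))|.
    apply: subset_leq_card; apply/subsetP=> z /setU1P[->|/setD1P[zc zij]].
      by rewrite !inE eqxx e_sym xc.
    rewrite inE; apply/andP; split; last by rewrite inE zij orbT.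
    rewrite inE; case/setUP: zij => [zi|zj]; first by apply: (line_clique li); rewrite // eq_sym.
    by apply: (line_clique lj); rewrite // eq_sym.
  rewrite cardsU1 (_ : x \notin _); last first.
    by apply/negP; rewrite !inE => /andP[_ /orP[/(line_adj li)|/(line_adj lj)]]; rewrite e_irr.
  have := cardsD1 c (Ci :|: Cj); rewrite inE ci /=; card_lia.
(* One further vertex [y] of [Ci] gives [#|Cj| + 1 <= 2 * #|Ci|], which for [#|Ci| = 3] contradicts
   [hj]. Two further vertices give disjoint sets inside the neighbours of [c] counted by [restN], so
   [3 * #|Cj| + 1 <= 4 * #|Ci|], against the bound from [L4]. *)
have Ci2 : #|Ci| = 2.
  have := cardsD1 c Ci; have := cardsD1 c' (Ci :\ c).
  rewrite ci !inE c'i eq_sym cc'_neq /= => E1 E2.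
  have [E|/set0Pn[y /setD1P[yc' /setD1P[yc yi]]]] := eqVneq (Ci :\ c :\ c') set0.
    by rewrite E cards0 in E1; card_lia.
  have [R1 S1] := rest y yi yc yc'; have := subset_leq_card S1.
  have E3 := cardsD1 y (Ci :\ c :\ c').
  rewrite !inE yc yc' yi /= in E3.
  have [E|/set0Pn[t /setD1P[ty /setD1P[tc' /setD1P[tc ti]]]]] := eqVneq (Ci :\ c :\ c' :\ y) set0.
    by rewrite E cards0 in E3; card_lia.
  have [R2 S2] := rest t ti tc tc'.
  have dis : (common_nbrs e c y :\: (x |: Ci)) :&: (common_nbrs e c t :\: (x |: Ci)) = set0.
    apply/setP=> r; rewrite !inE; apply/negP.
    case/andP=> /andP[/norP[rx ri] /andP[cr yr]] /andP[_ /andP[_ tr]].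
    case: (boolP (e x r)) => [xr|nxr].
      have [_ _ l3] := li; case/negP: ty; apply/eqP.
      by apply: (l3 r); rewrite // e_sym.
    apply: (@common_nbrs_at_most2 x r c y t); rewrite // 1?eq_sym // 1?[e r _]e_sym //.
    - exact: (line_adj li).
    - exact: (line_adj li).
  have SU : (common_nbrs e c y :\: (x |: Ci)) :|: (common_nbrs e c t :\: (x |: Ci))
      \subset N c :\: (x |: (Ci :|: Cj)) by rewrite subUset S1.
  have := subset_leq_card SU.
  have := cardsUI (common_nbrs e c y :\: (x |: Ci)) (common_nbrs e c t :\: (x |: Ci)).
  by rewrite dis cards0; card_lia.
split=> //; first card_lia.
split.
  move=> y xy; suff : #|Cj| <= (a x y).+1 by card_lia.
  have : y \in N x by rewrite inE.
  rewrite NE -setUA => /setUP[yi|/setUP[yj|yd]]; last 2 first.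
  - exact: (line_deg_ge lj).
  - by have := line_deg_ge ld yd; card_lia.
  have [->|yc] := eqVneq y c; first exact: (line_deg_ge lj).
  have [->|yc'] := eqVneq y c'; first by have := line_deg_ge ld c'd; card_lia.
  have := cardsD1 c Ci; have := cardsD1 c' (Ci :\ c); have := cardsD1 y (Ci :\ c :\ c').
  by rewrite ci !inE c'i yi yc yc' eq_sym cc'_neq /=; card_lia.
exists c, c', b; split=> //; first by rewrite e_sym.
card_lia.
Qed.
End PathOfLines.

(** In the common neighbourhood of [x] and [c], the two lines without [c] and the vertex [v] are
    pairwise apart, because [c] is already the one neighbour that an outside vertex may have on a
    line. The edge test on sizes 29, 9, 1 then yields [2756 <= 2755]. *)
Lemma two_long_lines_no_third x C C' c v : line x C -> line x C' -> distinct_lines C C' ->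
  30 <= #|C| -> 10 <= #|C'| -> c \in C -> c \in C' -> e x v -> e c v ->
  v \notin C -> v \notin C' -> False.
Proof.
move=> lC lC' [nC nC'] h h' cC cC' xv cv vC vC'.
have xc := line_adj lC cC.
have [D DC Dp] : exists2 D : {set T}, D \subset C :\ c & #|D| = 29.
  by apply: card_subset; have := cardsD1 c C; rewrite cC; card_lia.
have [D' DC' Dp'] : exists2 D : {set T}, D \subset C' :\ c & #|D| = 9.
  by apply: card_subset; have := cardsD1 c C'; rewrite cC'; card_lia.
have inD u : u \in D -> u \in C /\ u != c by move=> /(subsetP DC)/setD1P[].
have inD' u : u \in D' -> u \in C' /\ u != c by move=> /(subsetP DC')/setD1P[].
have [CN cliqueC l3] := lC; have [CN' cliqueC' l3'] := lC'.
have sub : D \subset common_nbrs e x c.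
  apply/subsetP=> u /inD[uC uc]; rewrite in_common (line_adj lC uC).
  by apply: cliqueC; rewrite // eq_sym.
have sub' : D' \subset common_nbrs e x c.
  apply/subsetP=> u /inD'[uC uc]; rewrite in_common (line_adj lC' uC).
  by apply: cliqueC'; rewrite // eq_sym.
have subv : [set v] \subset common_nbrs e x c by rewrite sub1set in_common xv.
have cD : is_clique e D by move=> s t /inD[sC _] /inD[tC _]; apply: cliqueC.
have cD' : is_clique e D' by move=> s t /inD'[sC _] /inD'[tC _]; apply: cliqueC'.
have apDD' : apart D D'.
  move=> s t /inD[sC sc] /inD'[tC' tc].
  have tC : t \notin C by apply/negP=> tC; case/eqP: tc; apply: (lines_meet lC lC').
  split; first by apply: contraNneq tC => <-.
  apply/negP=> st; case/eqP: sc; apply: (l3 t); rewrite // 1?[e t s]e_sym //.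
    exact: (line_adj lC').
  exact: cliqueC'.
have apv : apart D [set v].
  move=> s t /inD[sC sc]; rewrite inE => /eqP->.
  split; first by apply: contraNneq vC => <-.
  by apply/negP=> sv; case/eqP: sc; apply: (l3 v); rewrite // e_sym.
have apv' : apart D' [set v].
  move=> s t /inD'[sC sc]; rewrite inE => /eqP->.
  split; first by apply: contraNneq vC' => <-.
  by apply/negP=> sv; case/eqP: sc; apply: (l3' v); rewrite // e_sym.
have dv : {in [set v], forall w, #|N w :&: [set v]| <= 0}.
  move=> w; rewrite inE => /eqP->; rewrite leqn0 cards_eq0; apply/eqP/setP=> u.
  by rewrite !inE; case: eqVneq => [->|]; rewrite ?e_irr ?andbF.
have := @edge_test x c D D' [set v] 0 13 1 2 6 xc sub sub' subv cD cD' apDD' apv apv' dv.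
by rewrite Dp Dp' cards1; card_lia.
Qed.

Lemma apartC A B : apart A B -> apart B A.
Proof. by move=> ap u v uB vA; have [] := ap v u vA uB; rewrite eq_sym e_sym. Qed.

(** * Exact structure of the local graphs *)

Section ThreeLines.
Hypothesis k_ge120 : 120 <= k.
Variable x : T.
Hypothesis not_huge : forall C, line x C -> 2 * #|C| <= k.+1.

Definition line_triple (A B D : {set T}) : Prop :=
  [/\ [/\ line x A, line x B & line x D],
      [/\ distinct_lines A B, distinct_lines A D & distinct_lines B D],
      [/\ 10 <= #|A|, 10 <= #|B| & 10 <= #|D|] & N x = A :|: B :|: D].

Lemma line_triple_swap A B D : line_triple A B D -> line_triple B A D.
Proof.
by case=> [[lA lB lD] [nAB nAD nBD] [hA hB hD] NE]; split=> //; [case: nAB | rewrite NE (setUC A)].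
Qed.

Lemma line_triple_rot A B D : line_triple A B D -> line_triple B D A.
Proof.
case=> [[lA lB lD] [nAB nAD nBD] [hA hB hD] NE]; split=> //.
  by split=> //; apply: distinct_linesC.
by rewrite NE -setUA setUC.
Qed.

Lemma line_triple_no_third A B D c v : line_triple A B D ->
  c \in A -> c \in B -> e c v -> e x v -> v \in A :|: B.
Proof.
case=> [[lA lB lD] [nAB nAD nBD] [hA hB hD] NE] cA cB cv xv; apply/idPn.
rewrite inE negb_or => /andP[vA vB].
have := card_nbhd_three x A B D; rewrite -NE setDv cards0; have := not_huge lD => hu tot.
(* Since [not_huge] bounds [D], the lines [A] and [B] have at least 60 vertices in total, so one of
   them has 30. *)
have [h|h] := leqP 30 #|A|.
  exact: (@two_long_lines_no_third x A B c v).
by apply: (@two_long_lines_no_third x B A c v) => //; [exact: distinct_linesC | card_lia].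
Qed.

Lemma line_triple_free A B D : line_triple A B D ->
  exists2 y, y \in A & forall z, e x z -> e y z -> z \in A.
Proof.
case=> [[lA lB lD] [nAB nAD nBD] [hA hB hD] NE].
have [||E [EA E1 Efree]] := @free_part A [:: B; D] 1.
- by move=> C'; rewrite !inE => /orP[] /eqP->; apply: (@line_few_bridges x).
- by apply: leq_trans hA.
have /set0Pn[y yE] : E != set0 by rewrite -card_gt0 E1.
exists y; first exact: (subsetP EA).
move=> z xz yz; apply/idPn=> zA.
have : z \in N x by rewrite inE.
rewrite NE !inE (negbTE zA) /= => /orP[zB|zD].
  by have := Efree B y z; rewrite !inE eqxx zA zB yE yz => /(_ isT isT isT).
by have := Efree D y z; rewrite !inE eqxx zA zD yE yz orbT => /(_ isT isT isT).
Qed.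

Lemma line_triple_no_path A B D c c' : line_triple A B D ->
  c \in A -> c \in B -> c' \in A -> c' \in D -> False.
Proof.
move=> tr cA cB c'A c'D; have nt := line_triple_no_third tr cA cB.
case: (tr) => [[lA lB lD] [nAB nAD nBD] [hA hB hD] NE].
have [nAB1 nAB2] := nAB; have [nAD1 nAD2] := nAD; have [nBD1 nBD2] := nBD.
have [_ _ lD3] := lD.
have cD : c \notin D.
  apply/negP=> cD.
  have [v vD vAB] : exists2 v, v \in D & v != c.
    have /set0Pn[v /setD1P[]] : D :\ c != set0.
      by rewrite -card_gt0; have := cardsD1 c D; rewrite cD; card_lia.
    by exists v.
  have : v \in A :|: B.
    apply: nt; last exact: (line_adj lD).
    by apply: (line_clique lD); rewrite // eq_sym.
  case/setUP=> vC; case/eqP: vAB.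
    by apply: (lines_meet lA lD).
  by apply: (lines_meet lB lD).
have cc' : c != c' by apply: contraNneq cD => ->.
have disBD : [disjoint B & D].
  rewrite -setI_eq0; apply/eqP/setP=> t; rewrite !inE; apply/negP=> /andP[tB tD].
  have ct : c != t by apply: contraNneq cD => ->.
  have c't : c' = t.
    apply: (lD3 c) => //; first exact: (line_adj lA).
      exact: (line_clique lA).
    exact: (line_clique lB).
  case/eqP: cc'; apply: (lines_meet lA lB) => //.
  by rewrite c't.
have [] := @path_of_lines x A B D c c' lA lB lD nAB nAD NE cA cB c'A c'D cc' disBD; try card_lia.
Qed.

(** At a common vertex [c], all neighbours of [c] inside [N x] lie in [A :|: B], so [far_pair] with
    a free vertex of [D] applies to [c] as it does to free vertices of [A] and [B]. This makes
    [a x c] equal to [#|A| - 1], although [c] is joined to both whole lines. *)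
Lemma line_triple_disjoint A B D : line_triple A B D -> [disjoint A & B].
Proof.
move=> tr; rewrite -setI_eq0; apply/eqP/setP=> c; rewrite [RHS]inE; apply/negP=> /setIP[cA cB].
have tr' := line_triple_swap tr.
have nt := line_triple_no_third tr cA cB.
case: (tr) => [[lA lB lD] [nAB nAD nBD] [hA hB hD] NE].
have disA t : t \in A -> t \in D -> False.
  by move=> tA tD; apply: (line_triple_no_path tr cA cB tA tD).
have disB t : t \in B -> t \in D -> False.
  by move=> tB tD; apply: (line_triple_no_path tr' cB cA tB tD).
have [y yA fy] := line_triple_free tr.
have [z zB fz] := line_triple_free tr'.
have [v vD fv] := line_triple_free (line_triple_rot (line_triple_rot tr)).
have xy := line_adj lA yA; have xz := line_adj lB zB; have xv := line_adj lD vD.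
have ay := line_deg_eq lA yA fy; have az := line_deg_eq lB zB fz; have av := line_deg_eq lD vD fv.
have L1 : a x y + a x v = l.
  apply: far_pair => //.
  - by apply/eqP=> E; apply: (disA y); rewrite // E.
  - by apply/negP=> yv; apply: (disA v) => //; apply: fy.
  - by move=> t xt yt vt; apply: (disA t); [apply: fy | apply: fv].
have L2 : a x z + a x v = l.
  apply: far_pair => //.
  - by apply/eqP=> E; apply: (disB z); rewrite // E.
  - by apply/negP=> yv; apply: (disB v) => //; apply: fz.
  - by move=> t xt zt vt; apply: (disB t); [apply: fz | apply: fv].
have nD t : t \in D -> t \in A :|: B -> False by move=> tD /setUP[/disA|/disB]; apply.
have xc := line_adj lA cA.
have L3 : a x c + a x v = l.
  apply: far_pair => //.
  - by apply/eqP=> E; apply: (disA c); rewrite // E.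
  - by apply/negP=> cv; apply: (nD v) => //; apply: nt.
  - by move=> t xt ct vt; apply: (nD t); [apply: fv | apply: nt].
have B1 : #|A| + #|B| <= a x c + 2.
  have sub : (A :|: B) :\ c \subset common_nbrs e x c.
    apply/subsetP=> t /setD1P[tc /setUP[tA|tB]]; rewrite in_common.
      by rewrite (line_adj lA tA) (line_clique lA) // eq_sym.
    by rewrite (line_adj lB tB) (line_clique lB) // eq_sym.
  have := subset_leq_card sub; have := cardsD1 c (A :|: B); have := cardsUI A B.
  rewrite inE cA /= (_ : A :&: B = [set c]) ?cards1; first by card_lia.
  apply/setP=> t; rewrite !inE; apply/andP/eqP=> [[tA tB]|->]; last by split.
  by case: nAB => _ nAB; apply: (lines_meet lA lB).
by card_lia.
Qed.

(** A vertex with a bridge has too large a degree for [far_pair] with a free vertex of [D], so it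
    must also have a neighbour in [D]. Hence [a x z] is at least [s + 1], and [near_pair] leaves
    little for [a y z]. *)
Lemma line_triple_bridge A B D s y z : line_triple A B D ->
  [disjoint A & B] -> [disjoint A & D] -> [disjoint B & D] ->
  #|A| = s -> #|B| = s -> #|D| = s -> l.+2 = 2 * s -> y \in A -> z \in B -> e y z ->
  (a y z).+1 < s.
Proof.
move=> tr dAB dAD dBD sA sB sD ls yA zB yz.
have dis (P Q : {set T}) t : [disjoint P & Q] -> t \in P -> t \in Q -> False.
  by move=> /disjoint_setI0/setP/(_ t); rewrite !inE => h tP tQ; rewrite tP tQ in h.
case: (tr) => [[lA lB lD] [nAB nAD nBD] [hA hB hD] NE].
have [v vD fv] := line_triple_free (line_triple_rot (line_triple_rot tr)).
have av := line_deg_eq lD vD fv; have xv := line_adj lD vD.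
have third P t : line x P -> [disjoint P & D] -> #|P| = s -> t \in P ->
    (exists2 r, r \notin P & e x r /\ e t r) -> exists2 q, q \in D & e t q.
  move=> lP dPD sP tP [r rP [xr tr']].
  apply: exists_in_contra => nq.
  have L : a x t + a x v = l.
    apply: far_pair => //.
    - exact: (line_adj lP).
    - by apply/eqP=> E; apply: (dis P D t) => //; rewrite E.
    - exact: nq.
    - by move=> u xu tu vu; have := nq u (fv u xu vu); rewrite tu.
  have : #|r |: (P :\ t)| <= a x t.
    apply: subset_leq_card; apply/subsetP=> u /setU1P[->|/setD1P[ut uP]]; rewrite in_common ?xr //.
    by rewrite (line_adj lP uP) (line_clique lP) // eq_sym.
  have := cardsD1 t P; rewrite tP cardsU1 !inE (negbTE rP) andbF /=; card_lia.
have zA : z \notin A by apply/negP=> zA; apply: (dis A B z).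
have yB : y \notin B by apply/negP=> yB; apply: (dis A B y).
have xy := line_adj lA yA; have xz := line_adj lB zB.
have [q qD zq] : exists2 q, q \in D & e z q.
  by apply: (third B) => //; exists y => //; split; rewrite // e_sym.
have xq := line_adj lD qD.
have az : s.+1 <= a x z.
  have sub : y |: (q |: (B :\ z)) \subset common_nbrs e x z.
    apply/subsetP=> u /setU1P[->|/setU1P[->|/setD1P[uz uB]]]; rewrite in_common.
    - by rewrite xy e_sym.
    - by rewrite xq.
    - by rewrite (line_adj lB uB) (line_clique lB) // eq_sym.
  have qB : q \notin B by apply/negP=> qB; apply: (dis B D q).
  have yq : y != q by apply/eqP=> E; apply: (dis A D y); rewrite // E.
  have := subset_leq_card sub; rewrite !cardsU1 !inE (negbTE yq) (negbTE qB) (negbTE yB) !andbF /=.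
  by have := cardsD1 z B; rewrite zB; card_lia.
have [y1 y1A fy1] := line_triple_free tr.
have ny1z : ~~ e y1 z by apply/negP=> h; case/negP: zA; apply: fy1.
have y1y : y1 != y by apply: contraNneq ny1z => ->.
have L : a x z + a y z = l.
  apply: (@near_pair x z y1 y) => //; rewrite 1?[e z _]e_sym //.
  - exact: (line_adj lA).
  - by apply: contraNneq zA => ->.
  - exact: (line_clique lA).
by card_lia.
Qed.

Definition locally_three_cliques (s : nat) : Prop :=
  exists A B D : {set T}, [/\ N x = A :|: B :|: D,
    [/\ is_clique e A, is_clique e B & is_clique e D],
    [/\ #|A| = s, #|B| = s & #|D| = s] & [/\ apart A B, apart A D & apart B D]].

Lemma three_lines_structure A B D : line_triple A B D ->
  exists s, [/\ k = 3 * s, l.+2 = 2 * s, forall y, e x y -> s <= (a x y).+1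
    & locally_three_cliques s \/ exists y z, [/\ e x y, e y z & (a y z).+1 < s]].
Proof.
move=> tr; have trS := line_triple_swap tr.
have trR := line_triple_rot tr; have trRR := line_triple_rot trR.
have dAB := line_triple_disjoint tr; have dBD := line_triple_disjoint trR.
have dDA := line_triple_disjoint trRR; have dAD : [disjoint A & D] by rewrite disjoint_sym.
case: (tr) => [[lA lB lD] [nAB nAD nBD] [hA hB hD] NE].
have far P Q : line x P -> line x Q -> [disjoint P & Q] ->
    (exists2 y, y \in P & forall z, e x z -> e y z -> z \in P) ->
    (exists2 y, y \in Q & forall z, e x z -> e y z -> z \in Q) -> #|P| + #|Q| = l.+2.
  move=> lP lQ /disjoint_setI0/setP dPQ [y yP fy] [z zQ fz].
  have dis t : t \in P -> t \in Q -> False.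
    by move=> tP tQ; have := dPQ t; rewrite !inE tP tQ.
  have ay := line_deg_eq lP yP fy; have az := line_deg_eq lQ zQ fz.
  have : a x y + a x z = l; last by card_lia.
  apply: far_pair; [exact: (line_adj lP) | exact: (line_adj lQ) | | |].
  - by apply/eqP=> E; apply: (dis y); rewrite // E.
  - by apply/negP=> yz; apply: (dis z) => //; apply: fy => //; apply: (line_adj lQ).
  - by move=> t xt yt zt; apply: (dis t); [apply: fy | apply: fz].
have fA := line_triple_free tr; have fB := line_triple_free trR; have fD := line_triple_free trRR.
have E1 := far A B lA lB dAB fA fB; have E2 := far B D lB lD dBD fB fD.
have E3 := far D A lD lA dDA fD fA.
have sB : #|B| = #|A| by card_lia. have sD : #|D| = #|A| by card_lia.
have ls : l.+2 = 2 * #|A| by card_lia.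
exists #|A|; split=> //.
- rewrite -(reg x) NE; have := cardsUI (A :|: B) D; have := cardsUI A B.
  rewrite (disjoint_setI0 dAB) (_ : (A :|: B) :&: D = set0) ?cards0; first by card_lia.
  by rewrite setIUl (disjoint_setI0 dAD) (disjoint_setI0 dBD) setU0.
- move=> y xy; have : y \in N x by rewrite inE.
  rewrite NE -setUA => /setUP[yA|/setUP[yB|yD]]; first exact: line_deg_ge.
    by rewrite -sB; apply: line_deg_ge.
  by rewrite -sD; apply: line_deg_ge.
pose linked (P Q : {set T}) := [exists y in P, exists z in Q, e y z].
have ap (P Q : {set T}) : [disjoint P & Q] -> ~~ linked P Q -> apart P Q.
  move=> dPQ nl u v uP vQ; split.
    by apply/eqP=> uv; move/disjoint_setI0/setP/(_ u): dPQ; rewrite !inE uP uv vQ.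
  by apply: contraNN nl => uv; apply/exists_inP; exists u => //; apply/exists_inP; exists v.
have br P Q S : line_triple P Q S -> [disjoint P & Q] -> [disjoint P & S] -> [disjoint Q & S] ->
    #|P| = #|A| -> #|Q| = #|A| -> #|S| = #|A| -> linked P Q ->
    exists y z, [/\ e x y, e y z & (a y z).+1 < #|A|].
  move=> trP d1 d2 d3 s1 s2 s3 /exists_inP[y yP /exists_inP[z zQ yz]].
  exists y, z; split=> //; last exact: (line_triple_bridge trP d1 d2 d3 s1 s2 s3 ls yP zQ yz).
  by case: trP => [[lP _ _] _ _ _]; apply: (line_adj lP).
have [h|nAB'] := boolP (linked A B); first by right; apply: (br A B D).
have [h|nBD'] := boolP (linked B D).
  by right; apply: (br B D A) => //; rewrite disjoint_sym.
have [h|nDA'] := boolP (linked D A).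
  by right; apply: (br D A B) => //; rewrite disjoint_sym.
left; exists A, B, D; split=> //.
  by case: lA => _ ? _; case: lB => _ ? _; case: lD => _ ? _; split.
by split; [apply: ap | apply: apartC; apply: ap | apply: ap].
Qed.

End ThreeLines.

Definition locally_meeting_cliques x : Prop :=
  exists (C D : {set T}) (c : T) (s : nat),
    [/\ N x = C :|: D, is_clique e C /\ is_clique e D, #|C| = s /\ #|D| = s,
        C :&: D = [set c] /\ apart (C :\ c) (D :\ c) & k.+1 = 2 * s].

(** * Neighbourhoods dominated by two long lines *)

Section TwoLines.
Variable x : T.

Definition line_pair (A B : {set T}) : Prop :=
  [/\ line x A, line x B, distinct_lines A B, 32 <= #|A| /\ 32 <= #|B|
    & #|N x :\: (A :|: B)| <= 28 /\
      {in N x :\: (A :|: B), forall w, #|N w :&: (N x :\: (A :|: B))| <= 20}].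

Lemma line_pair_swap A B : line_pair A B -> line_pair B A.
Proof.
by case=> [lA lB [nAB nBA] [hA hB] [cW dW]]; split=> //; rewrite setUC.
Qed.

(** At most 20 neighbours in the rest, and one on each line. *)
Lemma line_pair_rest_deg A B w : line_pair A B ->
  w \in N x :\: (A :|: B) -> a x w <= 22.
Proof.
case=> [lA lB _ _ [_ dW]] wW; have dw := dW w wW.
move: (wW); rewrite !inE negb_or => /andP[/andP[wA wB] xw].
have [_ cA] := line_cross lA (subxx A) xw wA; have [_ cB] := line_cross lB (subxx B) xw wB.
have sub : common_nbrs e x w \subset
    (N w :&: (N x :\: (A :|: B))) :|: ((N w :&: A) :|: (N w :&: B)).
  apply/subsetP=> z; rewrite in_common !inE => /andP[-> ->].
  by case: (z \in A); case: (z \in B).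
have := subset_leq_card sub.
have := leq_of_leqif (leq_card_setU (N w :&: (N x :\: (A :|: B))) ((N w :&: A) :|: (N w :&: B))).
have := leq_of_leqif (leq_card_setU (N w :&: A) (N w :&: B)); card_lia.
Qed.

(** Clearing costs one vertex for [B] and one for each of the at most 28 vertices of the rest, fewer
    than the 32 available. *)
Lemma line_pair_free A B : line_pair A B ->
  exists2 y, y \in A & forall z, e x z -> e y z -> z \in A.
Proof.
case=> [lA lB _ [hA hB] [cW _]]; set W := N x :\: (A :|: B) in cW.
have [||E [EA E1 Efree]] := @free_part A (B :: [seq [set w] | w <- enum W]) 1.
- move=> C'; rewrite inE => /orP[/eqP->|/mapP[w]]; first exact: (@line_few_bridges x).
  rewrite mem_enum !inE => /andP[_ xw] ->; exact: (@vertex_few_bridges x).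
- by rewrite /= size_map -cardE; card_lia.
have /set0Pn[y yE] : E != set0 by rewrite -card_gt0 E1.
exists y; first exact: (subsetP EA).
move=> z xz yz; apply/idPn=> zA; have [zB|zB] := boolP (z \in B).
  by have := Efree B y z; rewrite !inE eqxx zA zB yE yz => /(_ isT isT isT).
have zW : z \in W by rewrite !inE negb_or zA zB.
have zin : [set z] \in B :: [seq [set w] | w <- enum W].
  by rewrite inE; apply/orP; right; apply/mapP; exists z; rewrite ?mem_enum.
by have := Efree [set z] y z zin yE; rewrite !inE eqxx zA yz => /(_ isT).
Qed.

Section Meeting.
Variables (A B : {set T}) (c : T).
Hypotheses (pr : line_pair A B) (cA : c \in A) (cB : c \in B).

Lemma meeting_no_third v : e x v -> e c v -> v \in A :|: B.
Proof.
case: pr => [lA lB nAB [hA hB] _] xv cv; apply/idPn; rewrite inE negb_or => /andP[vA vB].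
by apply: (@two_long_lines_no_third x A B c v) => //; card_lia.
Qed.

Lemma meeting_near z : z \in B -> (forall t, e x t -> e z t -> t \in B) ->
  z != c /\ a x z + a c z = l.
Proof.
move=> zB fz; case: pr => [lA lB [nAB nBA] _ _].
have [y yA yB] := subsetPn nAB.
have yc : y != c by apply: contraNneq yB => ->.
have xy := line_adj lA yA; have xz := line_adj lB zB; have xc := line_adj lA cA.
have cy : e c y by apply: (line_clique lA); rewrite // eq_sym.
have nzy : ~~ e z y by apply/negP=> zy; case/negP: yB; apply: fz.
have zc : z != c by apply: contraNneq nzy => ->.
split=> //; apply: (@near_pair x z y c) => //.
- by apply: contraNneq yB => <-.
- exact: (line_clique lB).
- by rewrite e_sym.
Qed.

(** Otherwise [far_pair] with a free vertex [z] of [B], compared with [meeting_near], gives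
    [a x w = a c z]. The left side is at most 22, the right side at least 31. *)
Lemma meeting_rest_avoid w : w \in N x :\: (A :|: B) -> exists2 t, t \in B & e w t.
Proof.
move=> wW; apply: exists_in_contra => nw.
have [z zB fz] := line_pair_free (line_pair_swap pr).
have [zc L] := meeting_near zB fz; have dw := line_pair_rest_deg pr wW.
case: pr => [lA lB _ [_ hB] _].
move: wW; rewrite !inE negb_or => /andP[/andP[wA wB] xw].
have az := line_deg_eq lB zB fz.
have B1 : #|B| <= (a c z).+1 by apply: (line_pair_deg_ge lB); rewrite // eq_sym.
have : a x w + a x z = l; last card_lia.
apply: far_pair => //; first exact: (line_adj lB).
- by apply: contraNneq wB => ->.
- exact: nw.
- by move=> v xv wv zv; have := nw v (fz v xv zv); rewrite wv.
Qed.

End Meeting.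

Lemma meeting_structure A B c : line_pair A B -> c \in A -> c \in B ->
  l.+1 = k /\ locally_meeting_cliques x.
Proof.
move=> pr cA cB; have pr' := line_pair_swap pr; have nt := meeting_no_third pr cA cB.
case: (pr) => [lA lB [nAB nBA] [hA hB] _].
have mt u : u \in A -> u \in B -> u = c by move=> *; apply: (lines_meet lA lB).
(* A vertex [w] of the rest is not adjacent to [c] but has neighbours [p] in [B] and [q] in [A], so
   [w] and [c] would share [x], [p] and [q]. *)
have W0 : N x :\: (A :|: B) = set0.
  apply/eqP/set0Pn=> -[w wW].
  have [p pB wp] := meeting_rest_avoid pr cA cB wW.
  have [q qA wq] : exists2 t, t \in A & e w t.
    by apply: (meeting_rest_avoid pr' cB cA); rewrite setUC.
  move: (wW); rewrite !inE negb_or => /andP[/andP[wA wB] xw].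
  have nwc : ~~ e w c.
    apply/negP=> wc; have := nt w xw; rewrite e_sym => /(_ wc).
    by rewrite inE (negbTE wA) (negbTE wB).
  have pc : p != c by apply: contraNneq nwc => <-.
  have qc : q != c by apply: contraNneq nwc => <-.
  apply: (@common_nbrs_at_most2 w c x p q) => //.
  - by apply: contraNneq wA => ->.
  - by rewrite e_sym.
  - by rewrite e_sym (line_adj lA).
  - by apply: (line_clique lB); rewrite // eq_sym.
  - by apply: (line_clique lA); rewrite // eq_sym.
  - by apply: adj_neq; apply: (line_adj lB).
  - by apply: adj_neq; apply: (line_adj lA).
  - by apply: contraNneq pc => pq; apply/eqP; apply: mt; rewrite // pq.
have NE : N x = A :|: B.
  apply/eqP; rewrite eqEsubset -setD_eq0 W0 eqxx subUset.
  by case: lA => -> _ _; case: lB => -> _ _.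
have cardAB : #|A| + #|B| = k.+1.
  rewrite -(reg x) NE -cardsUI (_ : A :&: B = [set c]) ?cards1 ?addn1 //.
  by apply/setP=> t; rewrite !inE; apply/andP/eqP=> [[]|->]; [apply: mt | split].
have xc := line_adj lA cA.
have Nc z : e c z -> z = x \/ e x z.
  have sub : x |: (N x :\ c) \subset N c.
    apply/subsetP=> t /setU1P[->|/setD1P[tc]]; first by rewrite inE e_sym.
    rewrite NE => /setUP[tA|tB]; rewrite inE; first by apply: (line_clique lA); rewrite // eq_sym.
    by apply: (line_clique lB); rewrite // eq_sym.
  have /eqP E : x |: (N x :\ c) == N c.
    rewrite eqEcard sub cardsU1 !inE e_irr andbF /= add1n.
    by have := cardsD1 c (N x); rewrite inE xc !reg add1n => <-.
  move=> cz; have : z \in N c by rewrite inE.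
  by rewrite -E !inE => /orP[/eqP->|/andP[_ ->]]; [left | right].
(* All neighbours of [c] lie in [x |: N x], so [a c z] is exactly [#|Q| - 1], like [a x z]. Used for
   both lines, this makes their sizes equal. *)
have card2 P Q : line_pair P Q -> c \in P -> c \in Q -> l.+2 = 2 * #|Q|.
  move=> prPQ cP cQ; have [z zQ fz] := line_pair_free (line_pair_swap prPQ).
  have [zc L] := meeting_near prPQ cP cQ zQ fz.
  case: prPQ => [_ lQ _ [_ hQ] _].
  have az := line_deg_eq lQ zQ fz.
  have B1 : #|Q| <= (a c z).+1 by apply: (line_pair_deg_ge lQ); rewrite // eq_sym.
  have : a c z <= #|x |: (Q :\ c :\ z)|.
    apply: subset_leq_card; apply/subsetP=> t; rewrite in_common => /andP[ct zt].
    have [->|xt] := Nc t ct; first by rewrite setU11.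
    by rewrite !inE (fz t) // ![t == _]eq_sym (adj_neq ct) (adj_neq zt) orbT.
  rewrite cardsU1; case: (x \notin Q :\ c :\ z); have := cardsD1 c Q;
    have := cardsD1 z (Q :\ c); rewrite cQ !inE zQ zc /=; card_lia.
have EB := card2 A B pr cA cB; have EA := card2 B A pr' cB cA.
split; first card_lia.
exists A, B, c, #|A|; split=> //.
- by case: lA => _ ? _; case: lB => _ ? _; split.
- by split=> //; card_lia.
- split.
    by apply/setP=> t; rewrite !inE; apply/andP/eqP=> [[]|->]; [apply: mt | split].
  move=> u v /setD1P[uc uA] /setD1P[vc vB].
  have vA : v \notin A by apply/negP=> vA; case/eqP: vc; apply: mt.
  split; first by apply: contraNneq vA => <-.
  have [_ _ lA3] := lA.
  apply/negP=> uv; case/eqP: uc; apply: (lA3 v) => //.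
  - exact: (line_adj lB).
  - by rewrite e_sym.
  - exact: (line_clique lB).
- card_lia.
Qed.

Section Disjoint.
Variables (A B : {set T}).
Hypotheses (pr : line_pair A B) (dAB : [disjoint A & B]).

Let dis t : t \in A -> t \in B -> False.
Proof. by move=> tA tB; move/disjoint_setI0/setP/(_ t): dAB; rewrite !inE tA tB. Qed.

Lemma disjoint_sum : #|A| + #|B| = l.+2.
Proof.
have [y yA fy] := line_pair_free pr; have [z zB fz] := line_pair_free (line_pair_swap pr).
case: pr => [lA lB _ _ _].
have ay := line_deg_eq lA yA fy; have az := line_deg_eq lB zB fz.
have : a x y + a x z = l; last by card_lia.
apply: far_pair; [exact: (line_adj lA) | exact: (line_adj lB) | | |].
- by apply/eqP=> E; apply: (dis (t := y)); rewrite // E.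
- by apply/negP=> yz; apply: (dis (t := z)) => //; apply: fy => //; apply: (line_adj lB).
- by move=> t xt yt zt; apply: (dis (t := t)); [apply: fy | apply: fz].
Qed.

(** Otherwise [far_pair] with a free vertex of [B] forces [a x w = #|A| - 1], which exceeds 22. *)
Lemma disjoint_rest_nbr w : w \in N x :\: (A :|: B) -> exists2 t, t \in B & e w t.
Proof.
move=> wW; apply: exists_in_contra => nw.
have [z zB fz] := line_pair_free (line_pair_swap pr).
have sumAB := disjoint_sum; have dw := line_pair_rest_deg pr wW.
case: pr => [lA lB _ [hA hB] _].
move: wW; rewrite !inE negb_or => /andP[/andP[wA wB] xw].
have az := line_deg_eq lB zB fz.
have : a x w + a x z = l; last card_lia.
apply: far_pair => //; first exact: (line_adj lB).
- by apply: contraNneq wB => ->.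
- exact: nw.
- by move=> v xv wv zv; have := nw v (fz v xv zv); rewrite wv.
Qed.

(** Otherwise [far_pair] forces [a x y = #|A| - 1], but [y] is adjacent to [w] as well as to the
    rest of its line. *)
Lemma disjoint_rest_link w y : w \in N x :\: (A :|: B) -> y \in A -> e y w ->
  exists2 t, t \in B & e y t.
Proof.
move=> wW yA yw; apply: exists_in_contra => ny.
have [z zB fz] := line_pair_free (line_pair_swap pr); have sumAB := disjoint_sum.
case: pr => [lA lB _ _ _].
have az := line_deg_eq lB zB fz.
have L : a x y + a x z = l.
  apply: far_pair; [exact: (line_adj lA) | exact: (line_adj lB) | | exact: ny |].
    by apply/eqP=> E; apply: (dis (t := y)); rewrite // E.
  by move=> v xv yv zv; have := ny v (fz v xv zv); rewrite yv.
move: wW; rewrite !inE negb_or => /andP[/andP[wA wB] xw].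
have : #|w |: (A :\ y)| <= a x y.
  apply: subset_leq_card; apply/subsetP=> u /setU1P[->|/setD1P[uy uA]]; rewrite in_common ?xw //.
  by rewrite (line_adj lA uA) (line_clique lA) // eq_sym.
have := cardsD1 y A; rewrite yA cardsU1 !inE (negbTE wA) andbF /=; card_lia.
Qed.

End Disjoint.

Lemma disjoint_structure A B : line_pair A B -> [disjoint A & B] ->
  l.+2 = k /\ (locally_two_cliques x \/ locally_linked x).
Proof.
move=> pr dAB; have pr' := line_pair_swap pr.
have dBA : [disjoint B & A] by rewrite disjoint_sym.
have sumAB := disjoint_sum pr dAB.
case: (pr) => [lA lB nAB [hA hB] _].
have [AN cA lA3] := lA; have [BN cB lB3] := lB.
have dis t : t \in A -> t \in B -> False.
  by move=> tA tB; move/disjoint_setI0/setP/(_ t): dAB; rewrite !inE tA tB.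
set W := N x :\: (A :|: B).
have swW w : w \in W -> w \in N x :\: (B :|: A) by rewrite setUC.
have NE : N x = W :|: A :|: B.
  apply/setP=> t; rewrite !inE; case tA: (t \in A); case tB: (t \in B); rewrite ?orbT ?orbF //=.
  - by have := subsetP AN t tA; rewrite inE.
  - by have := subsetP AN t tA; rewrite inE.
  - by have := subsetP BN t tB; rewrite inE.
have inW w : w \in W -> [/\ e x w, w \notin A & w \notin B].
  by rewrite !inE negb_or => /andP[/andP[-> ->] ->].
case: (boolP [exists u in A, exists v in B, e u v]) => [|nl]; last first.
  have nlink u v : u \in A -> v \in B -> ~~ e u v.
    move=> uA vB; apply: contraNN nl => uv.
    by apply/exists_inP; exists u => //; apply/exists_inP; exists v.
  have W0 : W = set0.
    apply/eqP/set0Pn=> -[w wW].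
    have [y yA wy] := disjoint_rest_nbr pr' dBA (swW w wW).
    have [t tB yt] : exists2 t, t \in B & e y t.
      by apply: (disjoint_rest_link pr dAB wW) => //; rewrite e_sym.
    by have := nlink y t yA tB; rewrite yt.
  have NAB : N x = A :|: B by rewrite NE W0 set0U.
  split; first by rewrite -sumAB -(reg x) NAB -cardsUI (disjoint_setI0 dAB) cards0 addn0.
  left; exists A, B; split=> //.
    by split; rewrite -card_gt0; card_lia.
  move=> u v uA vB; split; last exact: nlink.
  by apply/eqP=> uv; apply: (dis u); rewrite // uv.
case/exists_inP=> c cinA /exists_inP[c' cinB cc'].
have cB' : c \notin B by apply/negP=> h; apply: (dis c).
have c'A : c' \notin A by apply/negP=> h; apply: (dis c').
(* A neighbour of [w] on one line has a bridge to the other line, so it is the unique bridge end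
   there. *)
have Wc w : w \in W -> e w c /\ e w c'.
  move=> wW; split.
    have [y yA wy] := disjoint_rest_nbr pr' dBA (swW w wW).
    have [t tB yt] : exists2 t, t \in B & e y t.
      by apply: (disjoint_rest_link pr dAB wW) => //; rewrite e_sym.
    rewrite (_ : c = y) //.
    apply: (@line_bridge_uniq x A B c y c' t); rewrite // !inE ?c'A ?cinB //.
    by rewrite tB andbT; apply/negP=> h; apply: (dis t).
  have [y yB wy] := disjoint_rest_nbr pr dAB wW.
  have [t tA yt] : exists2 t, t \in A & e y t.
    by apply: (disjoint_rest_link pr' dBA (swW w wW)) => //; rewrite e_sym.
  rewrite (_ : c' = y) //; apply: (@line_bridge_uniq x B A c' y c t); rewrite // ?inE ?cB' ?cinA //.
    by rewrite tA andbT; apply/negP=> h; apply: (dis t).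
  by rewrite e_sym.
have xc := line_adj lA cinA; have xc' := line_adj lB cinB.
(* The edge [c c'] and the rest form a third line meeting [A] in [c] and [B] in [c'], the
   configuration of [path_of_lines]. *)
pose Ci := c |: (c' |: W).
have inCi t : t \in Ci -> [\/ t = c, t = c' | t \in W].
  by case/setU1P=> [->|/setU1P[->|]]; [constructor 1 | constructor 2 | constructor 3].
have li : line x Ci.
  split.
  - by rewrite !subUset !sub1set !inE xc xc' subsetDl.
  - move=> u v /inCi[->|->|uW] /inCi[->|->|vW] uv; rewrite ?eqxx // in uv *.
    + by rewrite e_sym; case: (Wc v vW).
    + by rewrite e_sym.
    + by rewrite e_sym; case: (Wc v vW).
    + by case: (Wc u uW).
    + by case: (Wc u uW).
    have [uc uc'] := Wc u uW; have [vc vc'] := Wc v vW.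
    have [xu _ _] := inW u uW; have [xv _ _] := inW v vW.
    apply/idPn=> nuv; apply: (@common_nbrs_at_most2 u v x c c'); rewrite // 1?[e _ x]e_sym //.
    + exact: adj_neq.
    + exact: adj_neq.
    + exact: adj_neq.
  move=> v u w xv vCi uCi wCi vu vw.
  have cCi : c \in Ci by rewrite setU11.
  have c'Ci : c' \in Ci by rewrite !inE eqxx orbT.
  have vW : v \notin W by apply: contraNN vCi => vW; rewrite setU1r // setU1r.
  have vc : v != c by apply: contraNneq vCi => ->.
  have vc' : v != c' by apply: contraNneq vCi => ->.
  have : v \in N x by rewrite inE.
  rewrite NE -setUA => /setUP[|/setUP[vA|vB]]; first by rewrite (negbTE vW).
    have only t : t \in Ci -> e v t -> t = c.
      case/inCi=> [//|->|tW] vt; case/eqP: vc.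
        by apply: (@line_bridge_uniq x A B v c c' c'); rewrite // !inE c'A.
      have [xt tA _] := inW t tW; apply: (lA3 t) => //; first by rewrite e_sym.
      by case: (Wc t tW).
    by rewrite (only u) // (only w).
  have only t : t \in Ci -> e v t -> t = c'.
    case/inCi=> [->|//|tW] vt; case/eqP: vc'.
      by apply: (@line_bridge_uniq x B A v c' c c); rewrite // ?inE ?cB' // e_sym.
    have [xt _ tB] := inW t tW; apply: (lB3 t) => //; first by rewrite e_sym.
    by case: (Wc t tW).
  by rewrite (only u) // (only w).
have notCi (P : {set T}) p : line x P -> 32 <= #|P| -> {in P, forall t, t \in Ci -> t = p} ->
    ~~ (P \subset Ci).
  move=> lP hP onlyp; apply/negP=> /subsetP PCi; move: hP; rewrite leqNgt => /negP; apply.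
  rewrite ltnS (@leq_trans 1) //; apply/card_le1_eqP=> u v uP vP.
  by apply: (etrans (onlyp _ _ (PCi _ _)) (esym (onlyp _ _ (PCi _ _)))).
have niA : distinct_lines Ci A.
  split; first by apply/subsetPn; exists c'; rewrite // !inE eqxx orbT.
  apply: (notCi _ c) => // t tA /inCi[//|E|/inW[_]]; last by rewrite tA.
  by rewrite -E tA in c'A.
have niB : distinct_lines Ci B.
  split; first by apply/subsetPn; exists c; rewrite // setU11.
  apply: (notCi _ c') => // t tB /inCi[E|//|/inW[_ _]]; last by rewrite tB.
  by rewrite -E tB in cB'.
have NEi : N x = Ci :|: A :|: B.
  rewrite NE; apply/setP=> t; rewrite !inE; apply/idP/idP.
    by case/orP=> [/orP[->|->]|->]; rewrite ?orbT.
  case/orP=> [/orP[/orP[/eqP->|/orP[/eqP->|->]]|->]|->]; rewrite ?orbT // ?cinA ?cinB ?orbT //.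
have hA7 : 7 <= #|A| by apply: leq_trans hA.
have hB7 : 7 <= #|B| by apply: leq_trans hB.
have cc'n : c != c' by apply: adj_neq.
have [_ lk ll] := @path_of_lines x Ci A B c c' li lA lB niA niB NEi (setU11 _ _) cinA
  ltac:(by rewrite !inE eqxx orbT) cinB cc'n dAB hA7 hB7.
by split=> //; right.
Qed.
End TwoLines.

(** * All vertices have the same type *)

Section Classification.
Hypothesis k_ge120 : 120 <= k.

Definition three_lines_type x : Prop := exists s,
  [/\ k = 3 * s, l.+2 = 2 * s, forall y, e x y -> s <= (a x y).+1
    & locally_three_cliques x s \/ exists y z, [/\ e x y, e y z & (a y z).+1 < s]].

Lemma local_classification x :
  [\/ l.+2 = k /\ locally_two_cliques x, l.+2 = k /\ locally_linked x,
      l.+1 = k /\ locally_meeting_cliques x | three_lines_type x].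
Proof.
case: (boolP [exists D : {set T}, [&& D \subset N x, cliqueb e D & k.+1 < 2 * #|D|]]).
  case/existsP=> D /and3P[DN /cliqueP cD hD]; constructor 1.
  have [C lC /subset_leq_card DC] := clique_sub_line DN cD.
  by apply: (huge_line_two_cliques lC); apply: leq_trans hD _; rewrite leq_mul2l.
move=> nhuge; have not_huge C : line x C -> 2 * #|C| <= k.+1.
  move=> [CN cC _]; rewrite leqNgt; apply: contraNN nhuge => hC.
  by apply/existsP; exists C; rewrite CN hC andbT; apply/cliqueP.
have [[A [B pr]]|[A [B [D tr]]]] := nbhd_cover k_ge120 not_huge; last first.
  by constructor 4; apply: (three_lines_structure k_ge120 not_huge tr).
have [dAB|] := boolP [disjoint A & B].
  by have [h [h1|h1]] := disjoint_structure pr dAB; [constructor 1 | constructor 2].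
rewrite -setI_eq0 => /set0Pn[c /setIP[cA cB]].
by constructor 3; apply: (meeting_structure pr cA cB).
Qed.

Lemma two_cliques_trans x u v w : locally_two_cliques x ->
  e x u -> e x v -> e x w -> u != w -> e u v -> e v w -> e u w.
Proof.
case=> C [D [NE cC cD _ ap]] xu xv xw uw uv vw.
have inN z : e x z -> z \in C \/ z \in D.
  by move=> xz; apply/setUP; rewrite -NE inE.
case: (inN v xv) => vS; case: (inN u xu) => uS; case: (inN w xw) => wS.
- exact: cC.
- by have [_] := ap v w vS wS; rewrite vw.
- by have [_] := ap v u vS uS; rewrite e_sym uv.
- by have [_] := ap v u vS uS; rewrite e_sym uv.
- by have [_] := ap u v uS vS; rewrite uv.
- by have [_] := ap u v uS vS; rewrite uv.
- by have [_] := ap w v wS vS; rewrite e_sym vw.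
- exact: cD.
Qed.

(** The contradiction is found at [c]: the induced path [b], [x], [c'] excludes two cliques, the
    small [a c c'] excludes a linked type, and the value of [l] excludes the others. *)
Lemma not_locally_linked x : l.+2 = k -> ~ locally_linked x.
Proof.
move=> lk [_ [c [c' [b [xc [cc' xc'] [cb xb] [bc' nbc'] hc]]]]].
case: (local_classification c) => [[_ tc]|[_ [h _]]|[lk' _]|[s [ks ls _ _]]].
- case/negP: nbc'; apply: (two_cliques_trans (v := x) tc) => //; rewrite // e_sym //.
- by have := h c' cc'; card_lia.
- by card_lia.
- by card_lia.
Qed.

(** The values of [k] and [l] force the three-line type at every vertex. A bridged edge [u v] at [y]
    would make [a u v] smaller than that type at [u] permits. *)
Lemma locally_three_cliques_type x y :
  three_lines_type x -> exists s, k = 3 * s /\ locally_three_cliques y s.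
Proof.
move=> tx.
have key u : three_lines_type x -> three_lines_type u.
  case=> s [ks ls _ _]; case: (local_classification u) => // -[lk _]; card_lia.
have [s [ks ls dmin [h|[u [v [yu uv huv]]]]]] := key y tx; first by exists s.
have [s' [ks' ls' dmin' _]] := key u tx.
by have := dmin' v uv; card_lia.
Qed.

Lemma locally_meeting_type y : l.+1 = k -> locally_meeting_cliques y.
Proof.
by move=> lk; case: (local_classification y) => [[h _]|[h _]|[//]|[s [ks ls _ _]]]; card_lia.
Qed.

(** * Divisibility from counting cliques *)

Lemma clique_count s r :
  (forall x, #|[set L : {set T} | [&& cliqueb e L, #|L| == s.+1 & x \in L]]| = r) ->
  s.+1 %| r * #|T|.
Proof.
move=> h; pose F := [set L : {set T} | cliqueb e L && (#|L| == s.+1)].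
suff -> : r * #|T| = #|F| * s.+1 by rewrite dvdn_mull.
transitivity (\sum_(x : T) \sum_(L in F) (x \in L)).
  rewrite (eq_bigr (fun=> r)) ?sum_nat_const 1?mulnC // => x _.
  rewrite -(h x) -sum1_card big_mkcond [RHS]big_mkcond /=; apply: eq_bigr => L _.
  by rewrite !inE andbA; case: (cliqueb _ _ && _); case: (x \in L).
rewrite exchange_big /= -sum_nat_const; apply: eq_bigr => L; rewrite inE => /andP[_ /eqP <-].
by rewrite -sum1_card [RHS]big_mkcond /=; apply: eq_bigr => x _; case: (x \in L).
Qed.

Lemma cliques_through x (Cs : seq {set T}) s : 0 < s -> uniq Cs ->
    (forall C, C \in Cs -> [/\ C \subset N x, is_clique e C & #|C| = s]) ->
    (forall L : {set T}, L \subset N x -> is_clique e L -> #|L| = s ->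
       exists2 C, C \in Cs & L \subset C) ->
  #|[set L : {set T} | [&& cliqueb e L, #|L| == s.+1 & x \in L]]| = size Cs.
Proof.
move=> s0 uCs hCs hL.
have xC C : C \in Cs -> x \notin C.
  by move=> /hCs[/subsetP CN _ _]; apply/negP=> /CN; rewrite inE e_irr.
have -> : [set L : {set T} | [&& cliqueb e L, #|L| == s.+1 & x \in L]]
    = [set L in [seq x |: C | C <- Cs]].
  apply/setP=> L; rewrite !inE; apply/and3P/mapP=> [[/cliqueP cL /eqP sL xL]|[C CC ->]].
    have sL' : #|L :\ x| = s by have := cardsD1 x L; rewrite xL sL => -[].
    have [||C CC LC] := hL (L :\ x) _ _ sL'.
    - by apply/subsetP=> u /setD1P[ux uL]; rewrite inE cL // eq_sym.
    - by apply: sub_clique cL; apply: subsetDl.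
    exists C => //; rewrite -[LHS](setD1K xL); congr (_ |: _); apply/eqP.
    by have [_ _ sC] := hCs C CC; rewrite eqEcard LC sL' sC leqnn.
  have [/subsetP CN cC sC] := hCs C CC; split; last exact: setU11.
    apply/cliqueP=> u v /setU1P[->|uC] /setU1P[->|vC] uv; rewrite ?eqxx // in uv *.
    - by have := CN v vC; rewrite inE.
    - by have := CN u uC; rewrite inE e_sym.
    - exact: cC.
  by rewrite cardsU1 xC // sC.
rewrite cardsE; have -> : #|[in [seq x |: C | C <- Cs]]| = size [seq x |: C | C <- Cs].
  apply/card_uniqP; rewrite map_inj_in_uniq // => C C' CC CC' E.
  by rewrite -(setU1K (xC C CC)) E setU1K // xC.
by rewrite size_map.
Qed.

(* Here [#|T| = 3 s^2 + 3 s + 1] and every vertex is in three cliques of size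
   [s + 1]. *)
Lemma not_three_lines_type x : ~ three_lines_type x.
Proof.
move=> tx; have [s [ks _]] := locally_three_cliques_type x tx.
have all3 y : locally_three_cliques y s.
  by have [s' [ks' h]] := locally_three_cliques_type y tx; have -> : s = s' by card_lia.
have s1 : 0 < s by card_lia.
have count y : #|[set L : {set T} | [&& cliqueb e L, #|L| == s.+1 & y \in L]]| = 3.
  have [A [B [D [NE [cA cB cD] [sA sB sD] [apAB apAD apBD]]]]] := all3 y.
  have neq (P Q : {set T}) : #|P| = s -> apart P Q -> P != Q.
    move=> sP ap; apply/eqP=> E; have /set0Pn[u uP] : P != set0 by rewrite -card_gt0 sP.
    by have [] := ap u u uP; rewrite -?E // eqxx.
  apply: (@cliques_through y [:: A; B; D]) => //.
  - by rewrite /= !inE negb_or !neq.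
  - move=> C; rewrite NE !inE => /or3P[] /eqP->; split=> //.
    + by rewrite -setUA subsetUl.
    + by rewrite setUAC subsetUr.
    + by rewrite subsetUr.
  move=> L LN cL sL; have /set0Pn[u uL] : L != set0 by rewrite -card_gt0 sL.
  have : u \in N y by apply: (subsetP LN).
  have sub (P : {set T}) :
      (forall v, v \in N y -> [\/ v \in P, apart [set v] P | apart P [set v]]) ->
      u \in P -> L \subset P.
    move=> h uP; apply/subsetP=> v vL; have [->//|uv] := eqVneq v u.
    have euv := cL v u vL uL uv.
    case: (h v (subsetP LN v vL)) => // ap.
      by have [_] := ap v u (set11 v) uP; rewrite euv.
    by have [_] := ap u v uP (set11 v); rewrite e_sym euv.
  have apr (P Q : {set T}) v : apart P Q -> v \in Q -> apart P [set v].
    by move=> ap vQ p q pP /set1P->; apply: ap.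
  have apl (P Q : {set T}) v : apart P Q -> v \in P -> apart [set v] Q.
    by move=> ap vQ p q /set1P-> qQ; apply: ap.
  rewrite NE -setUA => /setUP[uA|/setUP[uB|uD]].
  - exists A; first by rewrite !inE eqxx.
    apply: sub => // v; rewrite NE -setUA => /setUP[vA|/setUP[vB|vD]].
    + by constructor 1.
    + by constructor 3; apply: apr vB.
    + by constructor 3; apply: apr vD.
  - exists B; first by rewrite !inE eqxx orbT.
    apply: sub => // v; rewrite NE -setUA => /setUP[vA|/setUP[vB|vD]].
    + by constructor 2; apply: apl vA.
    + by constructor 1.
    + by constructor 3; apply: apr vD.
  - exists D; first by rewrite !inE eqxx !orbT.
    apply: sub => // v; rewrite NE -setUA => /setUP[vA|/setUP[vB|vD]].
    + by constructor 2; apply: apl vA.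
    + by constructor 2; apply: apl vB.
    + by constructor 1.
have := clique_count count.
have far y : y \in N x -> #|far_nbrs e x y| = 2 * s.
  rewrite inE => xy; have := card_far_nbrs xy.
  suff : (a x y).+1 = s by card_lia.
  have [A [B [D [NE [cA cB cD] [sA sB sD] [apAB apAD apBD]]]]] := all3 x.
  have deg (P : {set T}) : is_clique e P -> #|P| = s -> y \in P ->
     (forall v, v \in N x -> v \in P \/ ~~ e y v) -> P \subset N x -> (a x y).+1 = s.
    move=> cP sP yP hP PN; rewrite -sP (cardsD1 y P) yP add1n; congr S.
    apply: eq_card => v; rewrite in_common !inE; apply/andP/andP=> [[xv yv]|[vy vP]].
      split; first by rewrite eq_sym adj_neq.
      by case: (hP v); rewrite ?inE // yv.
    by have := subsetP PN v vP; rewrite inE => ->; split=> //; apply: cP; rewrite // eq_sym.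
  have : y \in N x by rewrite inE.
  rewrite {1}NE -setUA => /setUP[yP|/setUP[yP|yP]].
  - apply: (deg A) => //; last by rewrite NE -setUA subsetUl.
    move=> v; rewrite NE -setUA => /setUP[|/setUP[vB|vD]]; [by left | right | right].
      by have [] := apAB y v yP vB.
    by have [] := apAD y v yP vD.
  - apply: (deg B) => //; last by rewrite NE setUAC subsetUr.
    move=> v; rewrite NE -setUA => /setUP[vA|/setUP[vB|vD]]; [right | by left | right].
      by have [] := apAB v y vA yP; rewrite e_sym.
    by have [] := apBD y v yP vD.
  - apply: (deg D) => //; last by rewrite NE subsetUr.
    move=> v; rewrite NE -setUA => /setUP[vA|/setUP[vB|vD]]; [right | right | by left].
      by have [] := apAD v y vA yP; rewrite e_sym.
    by have [] := apBD v y vB yP; rewrite e_sym.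
have := sum_card_far_nbrs x; rewrite (eq_bigr _ far) sum_nat_const reg.
have := card_T_nbrs x; move: #|~: (x |: N x)| => m -> Em.
have -> : 3 * (k.+1 + m) = 9 * s * s.+1 + 3 by move: Em ks; clear; lia.
rewrite dvdn_addr ?dvdn_mull // => /dvdn_leq; move: ks k_ge120; clear; lia.
Qed.

(* Here [#|T| = s^2 + 1] and every vertex is in two cliques of size [s + 1]. *)
Lemma not_locally_meeting (x : T) : l.+1 <> k.
Proof.
move=> lk; have all2 := fun y => locally_meeting_type y lk.
have [C [D [c [s [NE [cC cD] [sC sD] [CD ap] ks]]]]] := all2 x.
have count y : #|[set L : {set T} | [&& cliqueb e L, #|L| == s.+1 & y \in L]]| = 2.
  have [A [B [c' [s' [NE' [cA cB] [sA sB] [AB ap'] ks']]]]] := all2 y.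
  have ss' : s' = s by card_lia.
  rewrite ss' in sA sB.
  apply: (@cliques_through y [:: A; B]) => //; first by card_lia.
  - rewrite /= !inE andbT; apply/eqP=> E; move: AB; rewrite -E setIid => AE.
    by move: sA; rewrite AE cards1; card_lia.
  - move=> P; rewrite NE' !inE => /orP[] /eqP->; split=> //; first exact: subsetUl.
    exact: subsetUr.
  move=> L LN cL sL.
  (* A vertex of [L] other than the shared [c'] decides which of the two cliques contains [L]. *)
  have /set0Pn[u /setD1P[uc uL]] : L :\ c' != set0.
    rewrite -card_gt0; have := cardsD1 c' L; rewrite sL.
    by case: (c' \in L); card_lia.
  have [c'A c'B] : c' \in A /\ c' \in B by apply/setIP; rewrite AB set11.
  have : u \in N y by apply: (subsetP LN).
  rewrite NE' => /setUP[uA|uB].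
    exists A; first by rewrite !inE eqxx.
    apply/subsetP=> v vL; have [->//|vu] := eqVneq v u; have [->//|vc] := eqVneq v c'.
    have : v \in N y by apply: (subsetP LN).
    rewrite NE' => /setUP[//|vB]; have [] := ap' u v; rewrite ?inE ?uc ?vc // => _.
    by rewrite cL // eq_sym.
  exists B; first by rewrite !inE eqxx orbT.
  apply/subsetP=> v vL; have [->//|vu] := eqVneq v u; have [->//|vc] := eqVneq v c'.
  have : v \in N y by apply: (subsetP LN).
  rewrite NE' => /setUP[vA|//]; have [] := ap' v u; rewrite ?inE ?uc ?vc // => _.
  by rewrite cL.
have := clique_count count.
have [cinC cinD] : c \in C /\ c \in D by apply/setIP; rewrite CD set11.
have CN : C \subset N x by rewrite NE subsetUl.
have DN : D \subset N x by rewrite NE subsetUr.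
have xc : e x c by have := subsetP CN c cinC; rewrite inE.
(* The shared vertex has no neighbours at distance two from [x]; the other [2 * (s - 1)] neighbours
   have [s - 1] each, which gives [(s - 1)^2] non-neighbours of [x]. *)
have farc : #|far_nbrs e x c| = 0.
  have := card_far_nbrs xc; suff : #|N x :\ c| <= a x c.
    by have := cardsD1 c (N x); rewrite inE xc reg; card_lia.
  apply: subset_leq_card; apply/subsetP=> v /setD1P[vc vN]; rewrite in_common.
  move: (vN); rewrite inE => ->; move: vN; rewrite NE => /setUP[vC|vD] /=.
    by apply: cC; rewrite // eq_sym.
  by apply: cD; rewrite // eq_sym.
have deg (P Q : {set T}) y : N x = P :|: Q -> is_clique e P -> #|P| = s ->
    apart (P :\ c) (Q :\ c) ->
    c \in P -> y \in P -> y != c -> (a x y).+1 = s.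
  move=> NPQ cP sP apPQ cinP yP yc; rewrite -sP (cardsD1 y P) yP add1n; congr S.
  apply: eq_card => v; rewrite in_common !inE; apply/andP/andP=> [[xv yv]|[vy vP]].
    split; first by rewrite eq_sym adj_neq.
    have : v \in N x by rewrite inE.
    rewrite NPQ => /setUP[//|vQ]; have [->//|vc] := eqVneq v c.
    have [_] : y != v /\ ~~ e y v by apply: apPQ; rewrite in_setD1 ?yc ?vc.
    by rewrite yv.
  have : v \in N x by rewrite NPQ inE vP.
  by rewrite inE => ->; split=> //; apply: cP; rewrite // eq_sym.
have far y : y \in N x :\ c -> #|far_nbrs e x y| = s.-1.
  case/setD1P=> yc yN; have xy : e x y by move: yN; rewrite inE.
  have := card_far_nbrs xy; suff : (a x y).+1 = s by card_lia.
  move: yN; rewrite NE => /setUP[yC|yD]; first exact: (deg C D).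
  by apply: (deg D C) => //; [rewrite setUC | apply: apartC].
have cN : #|N x :\ c| = 2 * s.-1.
  by have := cardsD1 c (N x); rewrite inE xc reg; card_lia.
have := sum_card_far_nbrs x; rewrite (big_setD1 c) ?inE //= farc (eq_bigr _ far) sum_nat_const cN.
have := card_T_nbrs x; move: #|~: (x |: N x)| => m -> Em.
have [r Er] : exists r, s = r.+1 by exists s.-1; card_lia.
have -> : 2 * (k.+1 + m) = 2 * r * s.+1 + 4 by move: Em ks; rewrite Er; clear; lia.
rewrite dvdn_addr ?dvdn_mull // => /dvdn_leq; move: ks k_ge120; clear; lia.
Qed.

Lemma everywhere_two_cliques x : l.+2 = k /\ locally_two_cliques x.
Proof.
case: (local_classification x) => [//|[lk /(not_locally_linked lk)]//|[lk _]|].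
  by case: (not_locally_meeting x lk).
by move/not_three_lines_type.
Qed.
End Classification.

(** * Coordinates *)

Section Grid.
Hypothesis two_cliques : forall x, locally_two_cliques x.
Variables (x : T).

Definition is_cross (C D : {set T}) : Prop :=
  [/\ N x = C :|: D, is_clique e C, is_clique e D & apart C D].

Lemma is_crossC C D : is_cross C D -> is_cross D C.
Proof. by case=> NE cC cD ap; split=> //; [rewrite setUC | apply: apartC]. Qed.

Section Projection.
Variables C D : {set T}.
Hypothesis crossCD : is_cross C D.

Let L := x |: C.
Let M := x |: D.

Lemma cross_adj u : u \in C -> e x u.
Proof. by case: crossCD => NE _ _ _ uC; have : u \in N x; [rewrite NE inE uC | rewrite inE]. Qed.

Lemma cross_clique : is_clique e L.
Proof.
case: (crossCD) => _ cC _ _ u v /setU1P[->|uC] /setU1P[->|vC] uv; rewrite ?eqxx // in uv *.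
- exact: cross_adj.
- by rewrite e_sym cross_adj.
- exact: cC.
Qed.

(** If both common neighbours [y], [z] of [x] and [u] were in [D], they would be adjacent, and
    transitivity in the local graph of [y] along [x], [z], [u] would make [x] and [u] adjacent. *)
Lemma cross_nbr_exists u : u \notin L -> exists2 p, p \in L & e u p.
Proof.
case: crossCD => NE cC cD ap; rewrite !inE negb_or => /andP[ux uC].
have [xu|nxu] := boolP (e x u); first by exists x; rewrite ?setU11 // e_sym.
have card2 : #|common_nbrs e x u| = 2 by rewrite mu2 // eq_sym.
have sub : ~~ (common_nbrs e x u \subset D).
  apply/negP=> /subsetP subD.
  have /set0Pn[y y_in] : common_nbrs e x u != set0 by rewrite -card_gt0 card2.
  have /set0Pn[z /setD1P[zy z_in]] : common_nbrs e x u :\ y != set0.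
    by rewrite -card_gt0; have := cardsD1 y (common_nbrs e x u); rewrite y_in card2 add1n => -[<-].
  move: (y_in) (z_in); rewrite !in_common => /andP[xy uy] /andP[xz uz].
  have yz : e y z by apply: cD; rewrite ?subD // eq_sym.
  case/negP: nxu; apply: (two_cliques_trans (v := z) (two_cliques y)) => //; rewrite 1?eq_sym //;
    by rewrite e_sym.
have [p] := subsetPn sub; rewrite in_common => /andP[xp up] pD.
exists p => //; apply/setU1P; right.
have : p \in N x by rewrite inE.
by rewrite NE inE (negbTE pD) orbF.
Qed.

Lemma cross_nbr_uniq u p q : u \notin L -> p \in L -> q \in L -> e u p -> e u q -> p = q.
Proof.
case: (crossCD) => NE cC cD ap uL pL qL up uq; apply/eqP/idPn=> pq.
have ux : u != x by apply: contraNneq uL => ->; rewrite setU11.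
have uC : u \notin C by apply: contraNN uL => uC; rewrite setU1r.
have nCu z : z \in C -> e u z -> ~~ e x u.
  move=> zC uz; apply/negP=> xu; have : u \in N x by rewrite inE.
  by rewrite NE inE (negbTE uC) /= => uD; have [_] := ap z u zC uD; rewrite e_sym uz.
have epq := cross_clique pL qL pq.
case/setU1P: pL => [px|pC]; case/setU1P: qL => [qx|qC].
- by rewrite px qx eqxx in pq.
- by have := nCu q qC uq; rewrite e_sym -px up.
- by have := nCu p pC up; rewrite e_sym -qx uq.
case/negP: (nCu p pC up).
apply: (two_cliques_trans (v := q) (two_cliques p)) => //.
- by rewrite e_sym cross_adj.
- by rewrite e_sym.
- by rewrite eq_sym.
- exact: cross_adj.
- by rewrite e_sym.
Qed.

(** The coordinate of [u] along the line [L] of the future grid. The default [x] is never reached: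
    outside [L] the neighbour exists and is unique. *)
Definition cross_proj (u : T) : T :=
  if u \in L then u else odflt x [pick p in L | e u p].

Lemma cross_proj_in u : cross_proj u \in L.
Proof.
by rewrite /cross_proj; case: ifP => // _; case: pickP => [p /andP[]|_] //=; rewrite setU11.
Qed.

Lemma cross_proj_id u : u \in L -> cross_proj u = u.
Proof. by rewrite /cross_proj => ->. Qed.

Lemma cross_projE u p : u \notin L -> p \in L -> e u p -> cross_proj u = p.
Proof.
move=> uL pL up; rewrite /cross_proj (negbTE uL); case: pickP => [q /andP[qL uq]|/(_ p)] /=.
  exact: (cross_nbr_uniq uL).
by rewrite pL up.
Qed.

Lemma cross_proj_adj u : u \notin L -> e u (cross_proj u).
Proof.
by move=> uL; have [p pL up] := cross_nbr_exists uL; rewrite (cross_projE uL pL up).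
Qed.

Lemma cross_proj_center u : (cross_proj u == x) = (u \in M).
Proof.
case: (crossCD) => NE cC cD ap; apply/eqP/idP=> [ux|/setU1P[->|uD]].
- have [uL|uL] := boolP (u \in L); first by rewrite -(cross_proj_id uL) ux setU11.
  have := cross_proj_adj uL; rewrite ux e_sym => xu.
  have : u \in N x by rewrite inE.
  rewrite NE inE => /orP[uC|uD]; last by rewrite setU1r.
  by rewrite setU1r in uL.
- by rewrite cross_proj_id // setU11.
have xu : e x u by have : u \in N x; [rewrite NE inE uD orbT | rewrite inE].
apply: cross_projE; rewrite ?setU11 // 1?e_sym // !inE negb_or eq_sym adj_neq //=.
by apply/negP=> uC; have [] := ap u u uC uD; rewrite eqxx.
Qed.

(** Away from [x] and [L], both [u] and [v] are neighbours of the common projection and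
    non-neighbours of [x]. So in its local graph they lie in the clique that does not contain
    [x]. *)
Lemma cross_fiber_clique u v : cross_proj u = cross_proj v -> u != v -> e u v.
Proof.
case: (crossCD) => NE cC cD ap puv uv.
have [ux|nux] := eqVneq (cross_proj u) x.
  have uM : u \in M by rewrite -cross_proj_center ux.
  have vM : v \in M by rewrite -cross_proj_center -puv ux.
  have xD z : z \in D -> e x z.
    by move=> zD; have : z \in N x; [rewrite NE inE zD orbT | rewrite inE].
  case/setU1P: uM uv => [->|uD]; case/setU1P: vM => [->|vD]; rewrite ?eqxx // => uv.
  - exact: xD.
  - by rewrite e_sym xD.
  - exact: cD.
have [uL|uL] := boolP (u \in L).
  have pu := cross_proj_id uL; have [vL|vL] := boolP (v \in L).
    by rewrite -pu puv cross_proj_id // eqxx in uv.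
  by rewrite e_sym -pu puv; apply: cross_proj_adj.
have up := cross_proj_adj uL.
have [vL|vL] := boolP (v \in L); first by rewrite -(cross_proj_id vL) -puv.
have vp := cross_proj_adj vL; rewrite -puv in vp.
have px : cross_proj u \in C.
  by case/setU1P: (cross_proj_in u) => // ux; rewrite ux eqxx in nux.
have nadj w : w \notin L -> cross_proj w != x -> w != x /\ ~~ e x w.
  move=> wL pw; split; first by apply: contraNneq wL => ->; rewrite setU11.
  apply/negP=> xw; have : w \in N x by rewrite inE.
  rewrite NE inE => /orP[wC|wD]; first by rewrite setU1r in wL.
  by case/negP: pw; rewrite cross_proj_center setU1r.
have [ux nxu] := nadj u uL nux.
have [vx nxv] : v != x /\ ~~ e x v by apply: nadj => //; rewrite -puv.
have [E [F [NEF cE cF _ apEF]]] := two_cliques (cross_proj u).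
have side (P Q : {set T}) : N (cross_proj u) = P :|: Q -> is_clique e P -> is_clique e Q ->
    x \in P -> e u v.
  move=> NPQ cP cQ xP.
  have inQ w : w != x -> ~~ e x w -> e w (cross_proj u) -> w \in Q.
    move=> wx nxw wp; have : w \in N (cross_proj u) by rewrite inE e_sym.
    rewrite NPQ => /setUP[wP|//].
    by case/negP: nxw; apply: cP; rewrite // eq_sym.
  by apply: cQ => //; apply: inQ.
have : x \in N (cross_proj u) by rewrite inE e_sym cross_adj.
rewrite NEF => /setUP[xE|xF]; first exact: (side E F).
by apply: (side F E) => //; rewrite setUC.
Qed.

End Projection.

Section Coordinates.
Variables C D : {set T}.
Hypothesis crossCD : is_cross C D.

Let L := x |: C.
Let M := x |: D.
Let f := cross_proj C.
Let g := cross_proj D.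
Let crossDC := is_crossC crossCD.

(** Off the axes, [f u] and [g u] are non-adjacent and share [x], [u] and [v]. *)
Lemma cross_coord_inj u v : f u = f v -> g u = g v -> u = v.
Proof.
move=> fuv guv; case: (crossCD) => NE cC cD ap.
have [fx|nfx] := eqVneq (f u) x.
  have uM : u \in M by rewrite -(cross_proj_center crossCD) -/f fx.
  have vM : v \in M by rewrite -(cross_proj_center crossCD) -/f -fuv fx.
  by rewrite -(cross_proj_id uM) -/g guv; apply: cross_proj_id.
have [gx|ngx] := eqVneq (g u) x.
  have uL : u \in L by rewrite -(cross_proj_center crossDC) -/g gx.
  have vL : v \in L by rewrite -(cross_proj_center crossDC) -/g -guv gx.
  by rewrite -(cross_proj_id uL) -/f fuv; apply: cross_proj_id.
have inC w : f w != x -> f w \in C.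
  by move=> h; case/setU1P: (cross_proj_in C w) => // E; rewrite /f E eqxx in h.
have inD w : g w != x -> g w \in D.
  by move=> h; case/setU1P: (cross_proj_in D w) => // E; rewrite /g E eqxx in h.
have out w : f w != x -> g w != x -> [/\ w \notin L, w \notin M & x != w].
  rewrite /f /g (cross_proj_center crossCD) (cross_proj_center crossDC) => wM wL.
  by split=> //; apply: contraNneq wL => <-; apply: setU11.
apply/eqP/idPn=> uv.
have [uL uM xu] := out u nfx ngx.
have [vL vM xv] : [/\ v \notin L, v \notin M & x != v] by apply: out; rewrite -?fuv -?guv.
have [fg nfg] := ap _ _ (inC u nfx) (inD u ngx).
apply: (@common_nbrs_at_most2 (f u) (g u) x u v) => //.
- by rewrite e_sym (cross_adj crossCD) // inC.
- by rewrite e_sym (cross_adj crossDC) // inD.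
- by rewrite e_sym; apply: (cross_proj_adj crossCD).
- by rewrite e_sym; apply: (cross_proj_adj crossDC).
- by rewrite fuv e_sym; apply: (cross_proj_adj crossCD).
- by rewrite guv e_sym; apply: (cross_proj_adj crossDC).
Qed.

(** Off the axes, the required vertex is the second common neighbour of [p] and [q] besides [x]. *)
Lemma cross_coord_surj p q : p \in L -> q \in M -> exists u, f u = p /\ g u = q.
Proof.
move=> pL qM; case: (crossCD) => NE cC cD ap.
have [px|npx] := eqVneq p x.
  exists q; split; last exact: cross_proj_id.
  by rewrite px; apply/eqP; rewrite /f (cross_proj_center crossCD).
have [qx|nqx] := eqVneq q x.
  exists p; split; first exact: cross_proj_id.
  by rewrite qx; apply/eqP; rewrite /g (cross_proj_center crossDC).
have pC : p \in C by case/setU1P: pL => // E; rewrite E eqxx in npx.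
have qD : q \in D by case/setU1P: qM => // E; rewrite E eqxx in nqx.
have [pq npq] := ap p q pC qD.
have xp := cross_adj crossCD pC; have xq := cross_adj crossDC qD.
have : common_nbrs e p q :\ x != set0.
  rewrite -card_gt0; have := cardsD1 x (common_nbrs e p q).
  by rewrite mu2 // in_common ![e _ x]e_sym xp xq add1n => -[<-].
case/set0Pn=> u; rewrite in_setD1 in_common => /and3P[ux pu qu].
have uL : u \notin L.
  rewrite !inE negb_or ux; apply/negP=> uC.
  by have [_] := ap u q uC qD; rewrite e_sym qu.
have uM : u \notin M.
  rewrite !inE negb_or ux; apply/negP=> uD.
  by have [_] := ap p u pC uD; rewrite pu.
exists u; split.
  by apply: (cross_projE crossCD) => //; rewrite e_sym.
by apply: (cross_projE crossDC) => //; rewrite e_sym.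
Qed.

Lemma card_cross_fiber p : p \in L -> #|[set w | f w == p]| = #|M|.
Proof.
move=> pL; rewrite -(card_in_imset (f := g) (D := [set w | f w == p])); last first.
  by move=> u v; rewrite !inE => /eqP fu /eqP fv; apply: cross_coord_inj; rewrite fu fv.
apply: eq_card => q; apply/imsetP/idP=> [[w _ ->]|qM]; first exact: cross_proj_in.
by have [u [fu gu]] := cross_coord_surj pL qM; exists u; rewrite ?inE ?fu.
Qed.

End Coordinates.

Lemma cross_card C D : is_cross C D -> #|x |: C| + #|x |: D| = k.+2.
Proof.
case=> NE _ _ ap.
have notx (P : {set T}) : P \subset N x -> x \notin P.
  by move=> /subsetP PN; apply/negP=> /PN; rewrite inE e_irr.
rewrite !cardsU1 !notx ?NE ?subsetUl ?subsetUr //.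
by have := cardsUI C D; rewrite (apart_disjoint ap) cards0 addn0 -NE reg => ->; card_lia.
Qed.

(** The two fibres through [u] are cliques meeting only in [u], with [k + 2] vertices counted
    separately; without [u] they supply [k] neighbours, hence all of them. *)
Lemma cross_adjE C D u v : is_cross C D -> u != v ->
  e u v = (cross_proj C u == cross_proj C v) || (cross_proj D u == cross_proj D v).
Proof.
move=> cr uv; have cr' := is_crossC cr.
pose F := [set w | cross_proj C w == cross_proj C u].
pose G := [set w | cross_proj D w == cross_proj D u].
have FG : F :&: G = [set u].
  apply/setP=> w; rewrite !inE; apply/andP/eqP=> [[/eqP fw /eqP gw]|->//].
  exact: (cross_coord_inj cr).
have sub : (F :|: G) :\ u \subset N u.
  apply/subsetP=> w /setD1P[wu /setUP[]]; rewrite !inE => /eqP h; rewrite e_sym.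
    exact: (cross_fiber_clique cr).
  exact: (cross_fiber_clique cr').
have cF : #|F| = #|x |: D| by apply: (card_cross_fiber cr); apply: cross_proj_in.
have cG : #|G| = #|x |: C| by apply: (card_cross_fiber cr'); apply: cross_proj_in.
have /eqP NuE : (F :|: G) :\ u == N u.
  rewrite eqEcard sub reg; have := cardsUI F G; rewrite FG cards1 cF cG.
  have := cross_card cr; have := cardsD1 u (F :|: G).
  have -> : u \in F :|: G by rewrite !inE eqxx.
  by card_lia.
have : (v \in N u) = (v \in (F :|: G) :\ u) by rewrite NuE.
by rewrite !inE eq_sym uv /= ![cross_proj _ u == _]eq_sym.
Qed.

Lemma grid_of_cross C D : is_cross C D ->
  graph_iso e (grid #|x |: C| #|x |: D|).
Proof.
move=> cr; have cr' := is_crossC cr.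
have xL : x \in x |: C by apply: setU11.
have xM : x \in x |: D by apply: setU11.
pose f := cross_proj C; pose g := cross_proj D.
pose phi u := (enum_rank_in xL (f u), enum_rank_in xM (g u)).
have rankL u v : (enum_rank_in xL (f u) == enum_rank_in xL (f v)) = (f u == f v).
  by apply/eqP/eqP=> [/enum_rank_in_inj|->] //; apply; apply: cross_proj_in.
have rankM u v : (enum_rank_in xM (g u) == enum_rank_in xM (g v)) = (g u == g v).
  by apply/eqP/eqP=> [/enum_rank_in_inj|->] //; apply; apply: cross_proj_in.
have fg_inj u v : f u = f v -> g u = g v -> u = v by apply: (cross_coord_inj cr).
exists phi.
  apply: inj_card_bij => [u v [/eqP hf /eqP hg]|].
    by apply: fg_inj; apply/eqP; rewrite -?rankL -?rankM.
  rewrite card_prod !card_ord -cardsX.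
  have fg_injective : injective (fun u => (f u, g u)) by move=> u v [] /fg_inj h /h.
  rewrite -(card_imset predT fg_injective); apply: subset_leq_card; apply/subsetP=> -[p q].
  rewrite inE /= => /andP[pL qM]; have [u [fu gu]] := cross_coord_surj cr pL qM.
  by apply/imsetP; exists u => //; rewrite /f /g fu gu.
move=> u v; rewrite /grid /cartesian_product /complete_rel /= !rankL !rankM.
have [->|uv] := eqVneq u v; first by rewrite !eqxx e_irr.
rewrite (cross_adjE cr uv) -/f -/g.
have := fg_inj u v; case: eqP => [fuv|_]; case: eqP => [guv|_] //= h.
by rewrite h ?eqxx in uv.
Qed.

End Grid.

Lemma strongly_co_edge_regular_grid : 120 <= k ->
  exists p q : nat, [/\ graph_iso e (grid p q), p + q = k + 2 & l = k - 2].
Proof.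
move=> k_ge120; have [x _|no_vertex] := pickP (@predT T); last first.
  by case: not_complete => x; have := no_vertex x.
have two y := everywhere_two_cliques k_ge120 y.
have [lk [C [D [NE cC cD _ ap]]]] := two x.
have cr : is_cross x C D by [].
exists #|x |: C|, #|x |: D|; split.
- exact: (grid_of_cross (fun y => (two y).2) cr).
- by rewrite (cross_card cr) addn2.
- by rewrite -lk subn2.
Qed.

End LocalStructure.

Theorem theorem1p4 (R : rcfType) (T : finType) (e : rel T) (n k l : nat)
    (e_sym : symmetric e) (e_irr : irreflexive e)
    (walk_reg : walk_regular e)
    (scer : strongly_co_edge_regular e n k 2 l)
    (min_eig : forall a : R, eigenvalue (adjmx e R) a -> (-3 <= a)%R)
    (k_ge120 : 120 <= k) :
  exists p q : nat, [/\ graph_iso e (grid p q), p + q = k + 2 & l = k - 2].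
Proof.
have [[_ reg not_complete _ mu2] strong] := scer.
have psd := set_form_ge0 (adj_form_ge0 (c := 3) e_sym min_eig).
exact: (strongly_co_edge_regular_grid e_sym e_irr reg mu2 strong not_complete psd k_ge120).
Qed.
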